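(* Let $C \subset \mathbb{P}^3$ be a reduced irreducible curve with homogeneous ideal $I_C \subset \mathbb{C}[x_1,x_2,x_3,x_4]$. Suppose $x_1^i x_2^j x_3^{k}$ is a minimal generator of $\mathrm{gin}(I_C)$ and that $x_1^i x_2^j x_3^{k-a}$, with $1 \le a \le k$, is a sporadic zero of degree $m = i+j+k-a$. Then for generic hyperplanes $H, H'$, the ideal $J = (I_C|_H : (H \cap H')^a)$ has a (minimal first) syzygy in degree $\le m+2$.
   Context: $\mathrm{gin}(I_C)$ is the generic initial ideal with respect to the reverse lexicographic order with $x_1 \succ x_2 \succ x_3 \succ x_4$. If $x_1^i x_2^j x_3^{f(i,j)}$ is a minimal generator of $\mathrm{gin}(I_C)$ with $f(i,j) > 0$, the monomials $x_1^i x_2^j x_3^{l}$ for $0 \le l < f(i,j)$ are called sporadic zeros. $I_C|_H$ denotes the image of $I_C$ in the homogeneous coordinate ring of the plane $H$ (a polynomial ring in three variables), and $H \cap H'$ denotes the linear form on $H$ induced by $H'$; $J$ is the ideal quotient of $I_C|_H$ by the $a$-th power of this linear form. ''$J$ has a syzygy in degree $\le m+2$'' means that the module of first syzygies among minimal generators of $J$ has a minimal generator of degree $\le m+2$. *)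

(* Defs.v *)
(* Base field: the complex numbers,
   realised as R[i] = complex numbers over Stdlib's real numbers R
   (which Rstruct equips with a real-closed field structure). *)
From HB Require Import structures.
From mathcomp Require Import all_boot all_order all_algebra.
From mathcomp Require Import Rstruct complex.
From mathcomp Require Import mpoly.

Set Implicit Arguments.
Unset Strict Implicit.
Unset Printing Implicit Defensive.

Import GRing.Theory.
Local Open Scope ring_scope.

Definition CC : Type := (Rdefinitions.R)[i].

(* The polynomial ring C[x_1,...,x_n] (variables indexed by 'I_n; x_1 is
   'X_0, x_2 is 'X_1, ...). *)
Notation CPoly n := {mpoly CC[n]}.

Definition is_ideal n (I : CPoly n -> Prop) : Prop :=
  [/\ I 0,
      (forall f g, I f -> I g -> I (f + g)) &
      (forall f g, I f -> I (g * f))].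

(* homogeneous of degree d (0 is homogeneous of every degree) *)
Definition homog_of n (d : nat) (p : CPoly n) : bool :=
  all (fun m => mdeg m == d) (msupp p).

Definition hcomp n (d : nat) (p : CPoly n) : CPoly n :=
  \sum_(m <- msupp p | mdeg m == d) p@_m *: 'X_[m].

Definition is_homog_ideal n (I : CPoly n -> Prop) : Prop :=
  is_ideal I /\ forall f d, I f -> I (hcomp d f).

Definition is_prime_ideal n (I : CPoly n -> Prop) : Prop :=
  [/\ is_ideal I, ~ I 1 & forall f g, I (f * g) -> I f \/ I g].

Definition strict_incl n (I J : CPoly n -> Prop) : Prop :=
  (forall f, I f -> J f) /\ exists f, J f /\ ~ I f.

(* Krull dimension of S/I equals 2 (for I prime): there is a chain of primes
   I < P1 < P2 of length 2, and none of length 3. *)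
Definition krull_dim_quot_eq2 n (I : CPoly n -> Prop) : Prop :=
  (exists P1 P2 : CPoly n -> Prop,
      [/\ is_prime_ideal P1, is_prime_ideal P2,
          strict_incl I P1 & strict_incl P1 P2]) /\
  ~ (exists P1 P2 P3 : CPoly n -> Prop,
      [/\ is_prime_ideal P1, is_prime_ideal P2, is_prime_ideal P3,
          strict_incl I P1 & strict_incl P1 P2 /\ strict_incl P2 P3]).

(* The homogeneous ideal I_C of a reduced irreducible curve C in P^3:
   a homogeneous prime ideal of C[x1..x4] whose quotient has Krull
   dimension 2 (projective dimension 1).  By the projective
   Nullstellensatz these are exactly the ideals I(C) of reduced irreducible
   curves C in P^3. *)
Definition is_curve_ideal (I : CPoly 4 -> Prop) : Prop :=
  [/\ is_homog_ideal I, is_prime_ideal I & krull_dim_quot_eq2 I].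

(* m >_revlex m' (intended for monomials of equal degree): the last
   variable in which they differ has smaller exponent in m. *)
Definition revlex_gt n (m m' : 'X_{1..n}) : Prop :=
  exists i : 'I_n, (m i < m' i)%N /\ forall j : 'I_n, (i < j)%N -> m j = m' j.

Definition drl_gt n (m m' : 'X_{1..n}) : Prop :=
  (mdeg m' < mdeg m)%N \/ (mdeg m = mdeg m' /\ revlex_gt m m').

Definition is_lead_mon n (f : CPoly n) (m : 'X_{1..n}) : Prop :=
  m \in msupp f /\ forall m', m' \in msupp f -> m' <> m -> drl_gt m m'.

Definition in_mon n (I : CPoly n -> Prop) (m : 'X_{1..n}) : Prop :=
  exists f, I f /\ is_lead_mon f m.

Definition linsubst n k (A : 'M[CC]_(n, k)) : n.-tuple (CPoly k) :=
  [tuple \sum_(j < k) A i j *: 'X_j | i < n].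

Definition transf_ideal n (g : 'M[CC]_n) (I : CPoly n -> Prop) : CPoly n -> Prop :=
  fun q => exists p, I p /\ q = p \mPo linsubst g.

(* M is (the set of monomials of) gin(I) for revlex: there is a nonempty
   Zariski open set of invertible coordinate changes g (the complement of
   the zero locus of a nonzero polynomial P in the 16 entries of g) on which
   in(g . I) = M. *)
Definition is_gin (I : CPoly 4 -> Prop) (M : 'X_{1..4} -> Prop) : Prop :=
  exists P : CPoly (4 * 4)%N, P != 0 /\
    forall g : 'M[CC]_4, P.@[fun k => mxvec g 0 k] != 0 -> g \in unitmx ->
      forall m, M m <-> in_mon (transf_ideal g I) m.

Definition mdiv n (m' m : 'X_{1..n}) : Prop := forall i, (m' i <= m i)%N.

Definition min_gen n (M : 'X_{1..n} -> Prop) (m : 'X_{1..n}) : Prop :=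
  M m /\ forall m', M m' -> mdiv m' m -> m' = m.

Definition mon3 (i j k : nat) : 'X_{1..4} :=
  [multinom (nth 0%N [:: i; j; k; 0%N] t) | t < 4].

Definition sporadic_zero (M : 'X_{1..4} -> Prop) (i j l : nat) : Prop :=
  exists f, (0 < f)%N /\ min_gen M (mon3 i j f) /\ (l < f)%N.

(* H is parametrised by an (injective) linear map phi : C^3 -> C^4, so that
   the homogeneous coordinate ring of H is identified with C[y1,y2,y3] and
   I|_H = { f o phi : f in I }. *)
Definition restr_ideal (phi : 'M[CC]_(4, 3)) (I : CPoly 4 -> Prop) : CPoly 3 -> Prop :=
  fun q => exists p, I p /\ q = p \mPo linsubst phi.

(* the linear form on H induced by the hyperplane H' = {h' . x = 0} *)
Definition induced_form (phi : 'M[CC]_(4, 3)) (h' : 'rV[CC]_4) : CPoly 3 :=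
  (\sum_(i < 4) h' 0 i *: 'X_i) \mPo linsubst phi.

Definition colon_pow (I : CPoly 3 -> Prop) (l : CPoly 3) (a : nat) : CPoly 3 -> Prop :=
  fun f => I (f * l ^+ a).

Definition pdeg n (p : CPoly n) : nat := (msize p).-1.

Definition min_hgens n (J : CPoly n -> Prop) (g : seq (CPoly n)) : Prop :=
  [/\ forall k, (k < size g)%N -> g`_k != 0 /\ homog_of (pdeg g`_k) g`_k,
      (forall f, J f <-> exists c : seq (CPoly n), size c = size g /\
                   f = \sum_(k < size g) c`_k * g`_k) &
      (forall k, (k < size g)%N -> ~ exists c : seq (CPoly n),
          size c = size g /\ g`_k = \sum_(l < size g | l != k :> nat) c`_l * g`_l)].

Definition syz_of_deg n (g : seq (CPoly n)) (d : nat) (s : seq (CPoly n)) : Prop :=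
  [/\ size s = size g,
      (forall k, (k < size g)%N ->
         if (pdeg g`_k <= d)%N then homog_of (d - pdeg g`_k) s`_k else s`_k == 0) &
      \sum_(k < size g) s`_k * g`_k = 0].

(* the syzygy module has a minimal generator in degree d: some syzygy of
   degree d is nonzero and not in (x_1,..,x_n) * Syz, i.e. not of the form
   sum_v x_v t_v with t_v syzygies of degree d-1 *)
Definition min_syz_in_deg n (g : seq (CPoly n)) (d : nat) : Prop :=
  exists s, syz_of_deg g d s /\ s <> nseq (size g) 0 /\
    ~ exists t : 'I_n -> seq (CPoly n),
        (0 < d)%N /\ (forall v, syz_of_deg g d.-1 (t v)) /\
        forall k, (k < size g)%N -> s`_k = \sum_(v < n) 'X_v * (t v)`_k.

Definition has_syz_le n (J : CPoly n -> Prop) (e : nat) : Prop :=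
  forall g, min_hgens J g -> exists2 d, (d <= e)%N & min_syz_in_deg g d.

(* Main.v *)
Require Import Defs.
From HB Require Import structures.
From mathcomp Require Import all_boot all_order all_algebra.
From mathcomp Require Import Rstruct complex.
From mathcomp Require Import mpoly ring zify.
From Stdlib Require Import Classical.

(** Put [S] for the polynomial ring in four variables and [A = S/I].  With [h]
    a form cutting out [H], the quotient ideal [J] consists of the restrictions
    of those [f] for which [h'^a f / h] lies in [A], and the generic initial
    ideal provides such an [f] of degree [m] which is not in [I + (h)].  Suppose
    that [J] has no syzygy of degree at most [m + 2].

    For generic [(H, H')] the relation [h'^a f = h q] in [A] deforms to first
    order with [h], because the linear system defining it has maximal rank
    there.  Differentiating it along a linear form [l] shows that [l f] is, up to
    [h A], [h] times an element of the same kind, so [f / h] represents a socle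
    element; the absence of syzygies makes the Koszul complex of [J] exact in
    these degrees, which forces [f - h w] to be divisible by [h^2] in the same
    sense for some [w].  To make this iterate when [J] is not saturated, the
    condition on [f / h^p] is weakened to [h'^a u f / h^p] being in [A] for all
    [u] of degree [p - 1].  One obtains for every [p] some [f_p] outside [I],
    congruent to [f] modulo [h], such that [u |-> h'^a u f_p / h^p] embeds the
    degree [p - 1] part of [A] in its part of degree [a + m - 1].  This is absurd
    for large [p], since the dimensions of the graded pieces of [A] are
    unbounded. *)

Set Implicit Arguments.
Unset Strict Implicit.
Unset Printing Implicit Defensive.

Import Order.TTheory GRing.Theory Num.Theory.
Local Open Scope ring_scope.

(** * Graded pieces *)

(* [shom e d c]: [c] is homogeneous of degree [e - d], the integer difference,
   so that [c = 0] when [e < d]. *)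
Definition shom n (F : nzRingType) (e d : nat) (c : {mpoly F[n]}) : bool :=
  if (d <= e)%N then c \is (e - d).-homog else c == 0.

Section Graded.
Variables (n : nat) (F : numFieldType).
Implicit Types (p q c : {mpoly F[n]}) (d e : nat).

Lemma mpolyXU_homog (i : 'I_n) : ('X_i : {mpoly F[n]}) \is 1.-homog.
Proof. by rewrite dhomogX /= mdeg1. Qed.

Lemma shom0 e d : shom e d (0 : {mpoly F[n]}).
Proof. by rewrite /shom; case: ifP => _; [apply: dhomog0 | apply: eqxx]. Qed.

Lemma shomD e d p q : shom e d p -> shom e d q -> shom e d (p + q).
Proof.
rewrite /shom; case: ifP => _; first exact: dhomogD.
by move=> /eqP -> /eqP ->; rewrite addr0.
Qed.

Lemma shomZ e d a p : shom e d p -> shom e d (a *: p).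
Proof.
rewrite /shom; case: ifP => _; first exact: dhomogZ.
by move=> /eqP ->; rewrite scaler0.
Qed.

Lemma shomN e d p : shom e d p -> shom e d (- p).
Proof. by rewrite -scaleN1r; exact: shomZ. Qed.

Lemma shomB e d p q : shom e d p -> shom e d q -> shom e d (p - q).
Proof. by move=> hp /shomN; exact: shomD. Qed.

Lemma shom_sum e d (I : Type) (r : seq I) (P : pred I) (f : I -> {mpoly F[n]}) :
  (forall i, P i -> shom e d (f i)) -> shom e d (\sum_(i <- r | P i) f i).
Proof.
by move=> h; elim/big_ind: _ => //; [exact: shom0 | exact: shomD].
Qed.

Lemma shomMhomog e d k p q :
  shom e d p -> q \is k.-homog -> shom (e + k) d (p * q).
Proof.
rewrite /shom => hp hq; case: leqP hp => [le_de hp|lt_ed /eqP ->].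
  by rewrite (leq_trans le_de (leq_addr _ _)) -addnBAC //; apply: dhomogM.
by rewrite mul0r; exact: shom0.
Qed.

Lemma shomM e d p q : shom e d p -> q \is d.-homog -> p * q \is e.-homog.
Proof.
rewrite /shom => hp hq; case: leqP hp => [le_de hp|lt_ed /eqP ->].
  by rewrite -[e in X in _ \is X](subnK le_de); apply: dhomogM.
by rewrite mul0r dhomog0.
Qed.

Lemma shomXl e d p (i : 'I_n) : shom e d p -> shom e.+1 d ('X_i * p).
Proof.
by move=> hp; rewrite mulrC -addn1; apply: shomMhomog (mpolyXU_homog i).
Qed.

Lemma shom_homog e p : shom e 0 p = (p \is e.-homog).
Proof. by rewrite /shom subn0. Qed.

Lemma mderiv_homog d p (i : 'I_n) : p \is d.+1.-homog -> p^`M(i) \is d.-homog.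
Proof.
move/dhomogP => hp; apply/dhomogP => m; rewrite mcoeff_msupp mcoeff_mderiv.
have [-> |nz _] := eqVneq (p@_(m + U_(i))) 0; first by rewrite mul0rn eqxx.
have := hp (m + U_(i))%MM; rewrite mcoeff_msupp nz => /(_ isT) /=.
by rewrite mdegD mdeg1 addn1 => -[].
Qed.

Lemma mderiv_homog0 p (i : 'I_n) : p \is 0.-homog -> p^`M(i) = 0.
Proof.
move=> hp; apply/mpolyP => m; rewrite mcoeff_mderiv mcoeff0.
by rewrite (dhomog_nemf_coeff hp) ?mul0rn //= mdegD mdeg1 addn1.
Qed.

Lemma shom_mderiv e d p (i : 'I_n) : shom e.+1 d p -> shom e d p^`M(i).
Proof.
rewrite /shom; have [le_de|lt_ed] := leqP d e.
  by rewrite (leqW le_de) subSn //; exact: mderiv_homog.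
have [eq_de|ne] := leqP d e.+1; last by move/eqP ->; rewrite mderiv0.
have -> : d = e.+1 by apply/eqP; rewrite eqn_leq lt_ed eq_de.
by rewrite subnn => /mderiv_homog0 ->.
Qed.

Lemma euler_homog d p :
  p \is d.-homog -> \sum_(i < n) 'X_i * p^`M(i) = d%:R *: p.
Proof.
move/dhomogP => hp.
have -> : p = \sum_(m <- msupp p) p@_m *: 'X_[m] by exact: mpolyE.
have -> : \sum_(i < n) 'X_i * (\sum_(m <- msupp p) p@_m *: 'X_[m])^`M(i)
  = \sum_(m <- msupp p) p@_m *: \sum_(i < n) 'X_i * 'X_[m]^`M(i).
  under eq_bigr => i _ do rewrite linear_sum mulr_sumr /=.
  rewrite exchange_big; apply: eq_bigr => m _; rewrite scaler_sumr.
  by apply: eq_bigr => i _; rewrite linearZ /= scalerAr.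
rewrite scaler_sumr big_seq [RHS]big_seq; apply: eq_bigr => m m_p.
rewrite scalerA mulrC -scalerA; congr (_ *: _).
have -> : d%:R *: 'X_[m] = \sum_(i < n) (m i)%:R *: 'X_[m] :> {mpoly F[n]}.
  by rewrite -(hp _ m_p) /= mdegE natr_sum scaler_suml.
apply: eq_bigr => i _; rewrite mderivX -scalerAr -mpolyXD.
have [->|m_gt0] := posnP (m i); first by rewrite !scale0r.
rewrite addmC submK //; apply/mnm_lepP => j; rewrite mnm1E.
by case: eqP => [<-|].
Qed.

Lemma euler_shom e d c :
  shom e d c -> \sum_(i < n) 'X_i * c^`M(i) = (e - d)%:R *: c.
Proof.
rewrite /shom; case: ifP => _; first exact: euler_homog.
move/eqP ->; rewrite scaler0 big1 // => i _; by rewrite mderiv0 mulr0.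
Qed.

Lemma mderivXU (i j : 'I_n) :
  ('X_i : {mpoly F[n]})^`M(j) = (i == j)%:R.
Proof.
rewrite mderivX mnm1E; case: eqP => [->|]; last by rewrite scale0r.
have -> : (U_(j) - U_(j) = 0 :> 'X_{1..n})%MM.
  by apply/mnmP => l; rewrite mnmBE subnn mnm0E.
by rewrite mpolyX0 scale1r.
Qed.

Lemma div_mulX (i : 'I_n) (f : 'I_n -> {mpoly F[n]}) :
  \sum_(j < n) ('X_i * f j)^`M(j) = f i + 'X_i * \sum_(j < n) (f j)^`M(j).
Proof.
under eq_bigr => j _ do rewrite mderivM mderivXU.
rewrite big_split /= -mulr_sumr; congr (_ + _).
rewrite (bigD1 i) //= eqxx mul1r big1 ?addr0 // => j.
by rewrite eq_sym => /negPf ->; rewrite mul0r.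
Qed.

Lemma div_Xmul e d c : shom e d c ->
  \sum_(j < n) ('X_j * c)^`M(j) = (n + (e - d))%:R *: c.
Proof.
move=> hc; under eq_bigr => j _ do rewrite mderivM mderivXU eqxx mul1r.
by rewrite big_split /= (euler_shom hc) sumr_const card_ord -scaler_nat natrD scalerDl.
Qed.

End Graded.

(* The de Rham differential is a contracting homotopy of the Koszul complex in
   each degree: the preimages are divergences. *)
Section Koszul.
Variables (n : nat) (F : numFieldType).
Local Notation R := {mpoly F[n.+3]}.

Lemma koszul1 e d (z : 'I_n.+3 -> R) :
    (forall i, shom e.+1 d (z i)) ->
    (forall i j, 'X_i * z j = 'X_j * z i) ->
  exists2 w, shom e d w & forall i, z i = 'X_i * w.
Proof.
(* The divergence over [j] of ['X_i * z j = 'X_j * z i] is [z i + 'X_i * div z] on the left and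
   [n.+3 + deg] times [z i] on the right; [N] is the difference of the two multiples of [z i]. *)
move=> hz zC; set N := (n.+2 + (e.+1 - d))%N.
have N0 : N%:R != 0 :> F by rewrite pnatr_eq0.
exists (N%:R^-1 *: \sum_(j < n.+3) (z j)^`M(j)).
  by apply/shomZ/shom_sum => i _; exact: shom_mderiv.
move=> i; rewrite -scalerAr; apply: (canRL (scalerK N0)).
have := div_mulX i z; under eq_bigr => j _ do rewrite zC.
rewrite (div_Xmul (hz i)) addSn -/N -natr1 scalerDl scale1r addrC.
by move/addrI.
Qed.

Lemma koszul2 e d (c : 'I_n.+3 -> 'I_n.+3 -> R) :
    (forall i j, shom e.+1 d (c i j)) ->
    (forall i j, c j i = - c i j) ->
    (forall l i j, 'X_l * c i j + 'X_i * c j l + 'X_j * c l i = 0) ->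
  exists2 v, forall i, shom e d (v i) &
    forall l j, c l j = 'X_l * v j - 'X_j * v l.
Proof.
(* In the divergence over [i] of the cocycle relation the middle term gives [n.+3 + deg] times
   [c j l] and the outer two give [2] times [c l j], whence this [N]. *)
move=> hc cN cC; set N := (n.+1 + (e.+1 - d))%N.
have N0 : N%:R != 0 :> F by rewrite pnatr_eq0.
exists (fun j => N%:R^-1 *: \sum_(i < n.+3) (c i j)^`M(i)).
  by move=> j; apply/shomZ/shom_sum => i _; exact: shom_mderiv.
move=> l j; rewrite -!scalerAr -scalerBr; apply: (canRL (scalerK N0)).
have : \sum_(i < n.+3) ('X_l * c i j + 'X_i * c j l + 'X_j * c l i)^`M(i) = 0.
  by rewrite big1 // => i _; rewrite cC mderiv0.
under eq_bigr => i _ do rewrite !mderivD (cN i l) mulrN mderivN.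
rewrite !big_split /= sumrN (div_mulX l (c^~ j)) (div_mulX j (c^~ l)).
rewrite (div_Xmul (hc j l)) (cN l j) scalerN.
have -> : (n.+3 + (e.+1 - d))%:R = N%:R + 2%:R :> F by rewrite -natrD addn2.
set A := \sum_(i < _) _; set B := \sum_(i < _) _; set C := c l j.
rewrite scalerDl [2%:R *: C]scaler_nat mulr2n; set D := N%:R *: C => h0.
by apply/eqP; rewrite -subr_eq0 -[X in _ == X]oppr0 -h0; apply/eqP; ring.
Qed.

End Koszul.

Lemma shomSS n (F : nzRingType) e d (c : {mpoly F[n]}) :
  shom e.+1 d.+1 c = shom e d c.
Proof. by rewrite /shom ltnS subSS. Qed.

Lemma pihomogM n (F : comNzRingType) e d (p q : {mpoly F[n]}) :
  q \is d.-homog ->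
  pihomog mdeg e (p * q) = if (d <= e)%N then pihomog mdeg (e - d) p * q else 0.
Proof.
move=> hq; set k := maxn (msize p) e.+1.
rewrite [in LHS](@pihomog_partitionE _ _ mdeg k p) ?leq_maxl // mulr_suml linear_sum /=.
have hpq (i : nat) : pihomog mdeg i p * q \is (i + d).-homog.
  by apply: dhomogM => //; exact: pihomogP.
case: leqP => [le_de|lt_ed]; last first.
  rewrite big1 // => i _; apply: (pihomog_ne0 _ (hpq i)).
  by apply/eqP => eqe; move: lt_ed; rewrite -eqe ltnNge leq_addl.
have lt_k : (e - d < k)%N.
  by apply: leq_ltn_trans (leq_subr _ _) _; rewrite leq_max ltnSn orbT.
rewrite (bigD1 (Ordinal lt_k)) //= pihomog_dE; last first.
  by have := hpq (e - d)%N; rewrite subnK.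
rewrite big1 ?addr0 // => i ne_i; apply: (pihomog_ne0 _ (hpq i)).
by apply: contraNneq ne_i => eqe; apply/eqP/val_inj; rewrite /= -eqe addnK.
Qed.

(** * Ideals without syzygies of low degree *)

Section NoSyzygy.
Variables (n r : nat) (F : numFieldType).
Local Notation R := {mpoly F[n.+3]}.
Variables (g : 'I_r -> R) (dg : 'I_r -> nat) (e0 : nat).

Definition in_gen (z : R) : Prop := exists c : 'I_r -> R, z = \sum_k c k * g k.

Hypothesis g_homog : forall k, g k \is (dg k).-homog.
Hypothesis nosyz : forall e (c : 'I_r -> R), (e <= e0)%N ->
  (forall k, shom e (dg k) (c k)) -> \sum_k c k * g k = 0 ->
  forall k, c k = 0.

Lemma in_gen_homog e z : in_gen z -> z \is e.-homog ->
  exists2 c : 'I_r -> R, forall k, shom e (dg k) (c k) & z = \sum_k c k * g k.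
Proof.
move=> [c ->] /pihomog_dE zE.
exists (fun k => if (dg k <= e)%N then pihomog mdeg (e - dg k) (c k) else 0).
  by move=> k; rewrite /shom; case: (dg k <= e)%N; [exact: pihomogP | exact: eqxx].
rewrite -zE linear_sum; apply: eq_bigr => k _ /=.
by rewrite (pihomogM _ _ (g_homog k)); case: ifP; rewrite ?mul0r.
Qed.

Lemma nosyz_uniq e (c c' : 'I_r -> R) : (e <= e0)%N ->
    (forall k, shom e (dg k) (c k)) -> (forall k, shom e (dg k) (c' k)) ->
  \sum_k c k * g k = \sum_k c' k * g k -> forall k, c k = c' k.
Proof.
move=> le_e hc hc' /eqP; rewrite -subr_eq0 -sumrB => /eqP eqc k.
apply/eqP; rewrite -subr_eq0; apply/eqP.
apply: (nosyz (c := fun k => c k - c' k) le_e) => [l|].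
  exact: shomB.
by rewrite -[RHS]eqc; apply: eq_bigr => l _; rewrite mulrBl.
Qed.

Lemma sum_mulXl (i : 'I_n.+3) (c : 'I_r -> R) :
  \sum_k 'X_i * c k * g k = 'X_i * \sum_k c k * g k.
Proof. by rewrite mulr_sumr; apply: eq_bigr => k _; rewrite mulrA. Qed.

(** Uniqueness of coefficients in degree [d.+2] gives ['X_i * c j k = 'X_j * c i k]; [koszul1] then
    divides each family [c _ k] by the variables, and one variable is cancelled. *)
Lemma nosyz_socle d z : (d.+2 <= e0)%N -> z \is d.-homog ->
  (forall i : 'I_n.+3, in_gen ('X_i * z)) -> in_gen z.
Proof.
move=> le_d hz zX.
have /fin_all_exists2 [c hc zE] : forall i : 'I_n.+3,
    exists2 c : 'I_r -> R, forall k, shom d.+1 (dg k) (c k) &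
    'X_i * z = \sum_k c k * g k.
  by move=> i; apply: in_gen_homog => //; rewrite -shom_homog; apply: shomXl; rewrite shom_homog.
have /fin_all_exists2 [w _ wE] : forall k : 'I_r,
    exists2 w, shom d (dg k) w & forall i, c i k = 'X_i * w.
  move=> k; apply: koszul1 => // i j.
  apply: (nosyz_uniq (c := fun k => 'X_i * c j k) (c' := fun k => 'X_j * c i k) le_d).
  - by move=> l; exact: shomXl.
  - by move=> l; exact: shomXl.
  - by rewrite !sum_mulXl -!zE; ring.
exists w; have X0 : 'X_ord0 != 0 :> R.
  by rewrite -msupp_eq0 msuppX.
apply: (mulfI X0); rewrite (zE ord0) -sum_mulXl.
by apply: eq_bigr => k _; rewrite wE.
Qed.

(** The coefficients of ['X_i * z j - 'X_j * z i] on the generators form a Koszul cocycle, hence a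
    coboundary by [koszul2]. Subtracting the elements [V i] of the ideal built from it turns the
    relations modulo the ideal into exact ones, which [koszul1] solves. *)
Lemma nosyz_koszul d (z : 'I_n.+3 -> R) : (d.+2 <= e0)%N ->
    (forall i, z i \is d.-homog) ->
    (forall i j, in_gen ('X_i * z j - 'X_j * z i)) ->
  exists2 w, shom d 1 w & forall i, in_gen (z i - 'X_i * w).
Proof.
move=> le_d hz zJ.
have /fin_all_exists2 [c hc zE] : forall ij : 'I_n.+3 * 'I_n.+3,
    exists2 c : 'I_r -> R, forall k, shom d.+1 (dg k) (c k) &
    'X_ij.1 * z ij.2 - 'X_ij.2 * z ij.1 = \sum_k c k * g k.
  move=> [i j]; apply: in_gen_homog => //=; rewrite -shom_homog.
  by apply: shomB; apply: shomXl; rewrite shom_homog.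
have /fin_all_exists2 [v hv vE] : forall k : 'I_r,
    exists2 v, forall i, shom d (dg k) (v i) &
    forall l j, c (l, j) k = 'X_l * v j - 'X_j * v l.
  move=> k; apply: (koszul2 (c := fun i j => c (i, j) k)) => // [i j|l i j].
    apply: (nosyz_uniq (c := c (j, i)) (c' := fun k => - c (i, j) k) (ltnW le_d)) => //.
      by move=> l; exact: shomN.
    under [RHS]eq_bigr => l _ do rewrite mulNr.
    by rewrite sumrN -!zE /=; ring.
  apply: (nosyz (c := fun k => 'X_l * c (i, j) k + 'X_i * c (j, l) k + 'X_j * c (l, i) k) le_d).
    by move=> k'; do !apply: shomD; exact: shomXl.
  under eq_bigr => k' _ do rewrite !mulrDl.
  by rewrite !big_split /= !sum_mulXl -!zE /=; ring.
pose V i := \sum_k v k i * g k.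
have hV i : V i \is d.-homog.
  by rewrite -shom_homog; apply: shom_sum => k _; rewrite shom_homog; apply: shomM.
have [|i j|w hw wE] := @koszul1 n F d 1 (fun i => z i - V i).
- by move=> i; rewrite shomSS shom_homog; apply: rpredB.
- have VE : 'X_i * V j - 'X_j * V i = 'X_i * z j - 'X_j * z i.
    rewrite (zE (i, j)) /V -!sum_mulXl -sumrB; apply: eq_bigr => k _.
    by rewrite vE; ring.
  apply/eqP; rewrite -subr_eq0; apply/eqP.
  transitivity (('X_i * z j - 'X_j * z i) - ('X_i * V j - 'X_j * V i)); first by ring.
  by rewrite VE subrr.
exists w => // i; exists (v^~ i); rewrite -wE -/(V i); ring.
Qed.

End NoSyzygy.

(** * The descent *)

Lemma ideal0 n (I : CPoly n -> Prop) : is_ideal I -> I 0.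
Proof. by case. Qed.

Lemma idealD n (I : CPoly n -> Prop) f g :
  is_ideal I -> I f -> I g -> I (f + g).
Proof. by case=> _ + _; exact. Qed.

Lemma idealM n (I : CPoly n -> Prop) f g : is_ideal I -> I f -> I (g * f).
Proof. by case=> _ _; exact. Qed.

Lemma idealZ n (I : CPoly n -> Prop) c f : is_ideal I -> I f -> I (c *: f).
Proof. by rewrite -mul_mpolyC; exact: idealM. Qed.

Lemma idealN n (I : CPoly n -> Prop) f : is_ideal I -> I f -> I (- f).
Proof. by rewrite -scaleN1r; exact: idealZ. Qed.

Lemma idealB n (I : CPoly n -> Prop) f g :
  is_ideal I -> I f -> I g -> I (f - g).
Proof. by move=> iI If /idealN -/(_ iI); exact: idealD. Qed.

Lemma ideal_sum n (I : CPoly n -> Prop) (T : Type) (r : seq T) (P : pred T)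
    (f : T -> CPoly n) :
  is_ideal I -> (forall i, P i -> I (f i)) -> I (\sum_(i <- r | P i) f i).
Proof.
move=> iI If; elim/big_ind: _ => //; first exact: ideal0.
by move=> x y; exact: idealD.
Qed.

Lemma primeX n (I : CPoly n -> Prop) f g k : is_prime_ideal I ->
  ~ I f -> I (f ^+ k * g) -> I g.
Proof.
move=> [_ _ pI] nIf; elim: k => [|k IHk]; first by rewrite expr0 mul1r.
by rewrite exprS -mulrA => /pI [].
Qed.

Section Descent.
Variables (I : CPoly 4 -> Prop) (h h' : CPoly 4) (a : nat).

(* [in_colon q] is the ideal [(I + (h^q)) : h'^a], and [in_mcolon p q] its
   quotient by the [p]-th power of the maximal ideal. *)
Definition in_colon (q : nat) (G : CPoly 4) : Prop :=
  exists r, I (h' ^+ a * G - h ^+ q * r).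

Fixpoint in_mcolon (p q : nat) (G : CPoly 4) : Prop :=
  if p is p'.+1 then forall i : 'I_4, in_mcolon p' q ('X_i * G)
  else in_colon q G.

Hypothesis primeI : is_prime_ideal I.
Hypothesis h_notin : ~ I h.

Let idI : is_ideal I. Proof. by case: primeI. Qed.

Lemma in_colonD q G1 G2 : in_colon q G1 -> in_colon q G2 -> in_colon q (G1 + G2).
Proof.
move=> [r1 I1] [r2 I2]; exists (r1 + r2).
suff -> : h' ^+ a * (G1 + G2) - h ^+ q * (r1 + r2) =
  (h' ^+ a * G1 - h ^+ q * r1) + (h' ^+ a * G2 - h ^+ q * r2) by exact: idealD.
by ring.
Qed.

Lemma in_colonM q s G : in_colon q G -> in_colon q (s * G).
Proof.
move=> [r Ir]; exists (s * r).
suff -> : h' ^+ a * (s * G) - h ^+ q * (s * r) = s * (h' ^+ a * G - h ^+ q * r).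
  exact: idealM.
by ring.
Qed.

Lemma in_colon_hM q k G : in_colon q G -> in_colon (k + q) (h ^+ k * G).
Proof.
move=> [r Ir]; exists r; rewrite exprD.
suff -> : h' ^+ a * (h ^+ k * G) - h ^+ k * h ^+ q * r =
  h ^+ k * (h' ^+ a * G - h ^+ q * r) by exact: idealM.
by ring.
Qed.

Lemma in_colon_cancel q k G : in_colon (k + q) (h ^+ k * G) -> in_colon q G.
Proof.
move=> [r Ir]; exists r; apply: (primeX (k := k) primeI h_notin).
move: Ir; rewrite exprD; congr I; ring.
Qed.

Lemma in_colon_hX q G : in_colon q (h ^+ q * G).
Proof.
exists (h' ^+ a * G); suff -> : h' ^+ a * (h ^+ q * G) - h ^+ q * (h' ^+ a * G) = 0.
  exact: ideal0.
by ring.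
Qed.

Lemma in_mcolonD p q G1 G2 :
  in_mcolon p q G1 -> in_mcolon p q G2 -> in_mcolon p q (G1 + G2).
Proof.
elim: p G1 G2 => [|p IHp] G1 G2 /=; first exact: in_colonD.
by move=> E1 E2 i; rewrite mulrDr; apply: IHp.
Qed.

Lemma in_mcolonM p q s G : in_mcolon p q G -> in_mcolon p q (s * G).
Proof.
elim: p G => [|p IHp] G /=; first exact: in_colonM.
by move=> E1 i; rewrite mulrCA; apply: IHp.
Qed.

Lemma in_mcolonZ p q c G : in_mcolon p q G -> in_mcolon p q (c *: G).
Proof. by rewrite -mul_mpolyC; exact: in_mcolonM. Qed.

Lemma in_mcolonB p q G1 G2 :
  in_mcolon p q G1 -> in_mcolon p q G2 -> in_mcolon p q (G1 - G2).
Proof.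
by move=> E1 /(in_mcolonZ (-1)); rewrite scaleN1r; exact: in_mcolonD.
Qed.

Lemma in_colonW p q G : in_colon q G -> in_mcolon p q G.
Proof.
by elim: p G => [|p IHp] G //= E i; apply: IHp; exact: in_colonM.
Qed.

Lemma in_mcolon_sum p q (T : Type) (r : seq T) (G : T -> CPoly 4) :
  (forall i, in_mcolon p q (G i)) -> in_mcolon p q (\sum_(i <- r) G i).
Proof.
move=> EG; elim/big_ind: _ => //; last exact: in_mcolonD.
by apply: in_colonW; rewrite -(mulr0 (h ^+ q)); exact: in_colon_hX.
Qed.

Lemma in_mcolon_hM p q k G :
  in_mcolon p q G -> in_mcolon p (k + q) (h ^+ k * G).
Proof.
elim: p G => [|p IHp] G /=; first exact: in_colon_hM.
by move=> E i; rewrite mulrCA; apply: IHp.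
Qed.

Lemma in_mcolon_cancel p q k G :
  in_mcolon p (k + q) (h ^+ k * G) -> in_mcolon p q G.
Proof.
elim: p G => [|p IHp] G /=; first exact: in_colon_cancel.
by move=> E i; apply: IHp; rewrite mulrCA.
Qed.

Lemma in_mcolon_linear p q (c : 'I_4 -> CC) G :
  in_mcolon p.+1 q G -> in_mcolon p q ((\sum_i c i *: 'X_i) * G).
Proof.
move=> /= E; rewrite mulr_suml; apply: in_mcolon_sum => i.
by rewrite -scalerAl; apply: in_mcolonZ.
Qed.

Variables (l : 'I_3 -> CPoly 4) (m : nat).
Hypothesis h_homog : h \is 1.-homog.
Hypothesis l_homog : forall j, l j \is 1.-homog.
Hypothesis h_linear : exists c : 'I_4 -> CC, h = \sum_i c i *: 'X_i.
Hypothesis l_linear : forall j, exists c : 'I_4 -> CC, l j = \sum_i c i *: 'X_i.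
Hypothesis X_span : forall i : 'I_4, exists (c : 'I_3 -> CC) (d : CC),
  'X_i = \sum_j c j *: l j + d *: h.

Hypothesis socle_free : forall d z, (d <= m)%N -> z \is d.-homog ->
  (forall j, in_colon 1 (l j * z)) -> in_colon 1 z.
Hypothesis koszul_exact : forall d (w : 'I_3 -> CPoly 4), (d <= m)%N ->
  (forall j, w j \is d.-homog) ->
  (forall i j, in_colon 1 (l i * w j - l j * w i)) ->
  exists2 w0, shom d 1 w0 & forall j, in_colon 1 (w j - l j * w0).

(** The bound [P] is there because each [p] costs a genericity condition, and only finitely many can
    be imposed at once. *)
Variable P : nat.
Hypothesis tangent : forall p f, (p < P)%N -> f \is m.-homog ->
  in_mcolon p p.+1 f -> forall j, exists2 f', f' \is m.-homog &
  in_mcolon p p.+2 (h * f' + p.+1%:R *: (l j * f)).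

Lemma in_mcolon_l p q j G : in_mcolon p.+1 q G -> in_mcolon p q (l j * G).
Proof. by have [c ->] := l_linear j; exact: in_mcolon_linear. Qed.

Lemma in_mcolon_h p q G : in_mcolon p.+1 q G -> in_mcolon p q (h * G).
Proof. by have [c ->] := h_linear; exact: in_mcolon_linear. Qed.

(** Multiplication by [l j] raises the degree by one and spends one power of the maximal ideal, so
    [socle_free] is used in degrees [d] to [d + q - 1], all at most [m]. *)
Lemma socle_free_iter q d z : (d + q <= m.+1)%N -> z \is d.-homog ->
  in_mcolon q 1 z -> in_colon 1 z.
Proof.
elim: q d z => [|q IHq] d z //= le_dq hz Ez.
apply: (@socle_free d) => // [|j].
  by move: le_dq; rewrite addnS ltnS; apply: leq_trans; exact: leq_addr.
apply: (IHq d.+1); first by rewrite addSnnS.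
  exact: dhomogM (l_homog j) hz.
exact: (@in_mcolon_l q).
Qed.

(** Replacing [f' j] by [h ^+ p * w j] turns the tangent relation into [l j * f = h ^+ p.+1 * W j]
    up to [in_mcolon p p.+2]. Cross-multiplying yields the Koszul relations for [W], so [W j] is
    [l j * w0] up to [in_colon 1], and [w0] provides the correction of [f]. *)
Lemma descent_core p f (f' w : 'I_3 -> CPoly 4) :
    (forall j, shom m p (w j)) -> in_mcolon p p.+1 f ->
    (forall j, in_mcolon p p.+2 (h * f' j + p.+1%:R *: (l j * f))) ->
    (forall j, in_mcolon p p.+1 (f' j - h ^+ p * w j)) ->
  exists2 w0, shom m p.+1 w0 & in_mcolon p.+1 p.+2 (f - h ^+ p.+1 * w0).
Proof.
move=> hw Ef Ef' Ew; have p0 : p.+1%:R != 0 :> CC by rewrite pnatr_eq0.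
pose W j := - (p.+1%:R^-1 *: w j).
have hW j : shom m p (W j) by apply/shomN/shomZ.
have EW j : in_mcolon p p.+2 (l j * f - h ^+ p.+1 * W j).
  have := in_mcolonB (Ef' j) (in_mcolon_hM 1 (Ew j)).
  move/(in_mcolonZ p.+1%:R^-1); congr (in_mcolon _ _ _).
  set T := _ *: (l j * f).
  have -> : h * f' j + T - h ^+ 1 * (f' j - h ^+ p * w j) = T + h ^+ p.+1 * w j.
    by rewrite (exprS h p) expr1; ring.
  by rewrite scalerDr scalerK // /W mulrN opprK scalerAr.
suff [w0 hw0 Ew0] : exists2 w0, shom m p.+1 w0 &
    forall j, in_colon 1 (W j - l j * w0).
  (* The [l j] and [h] span the linear forms, so it suffices to multiply by each of them. *)
  exists w0 => //= i; have [c [d ->]] := X_span i.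
  rewrite mulrDl mulr_suml; apply: in_mcolonD.
    apply: in_mcolon_sum => j; rewrite -scalerAl; apply: in_mcolonZ.
    have -> : l j * (f - h ^+ p.+1 * w0) =
      (l j * f - h ^+ p.+1 * W j) + h ^+ p.+1 * (W j - l j * w0) by ring.
    apply: in_mcolonD => //; apply: in_colonW; rewrite -addn1.
    exact: in_colon_hM.
  rewrite -scalerAl mulrBr; apply/in_mcolonZ/in_mcolonB.
    exact: (in_mcolon_hM 1 Ef).
  by rewrite mulrA -exprS; apply: in_colonW; exact: in_colon_hX.
(* For [p > m] the [W j] vanish for degree reasons. *)
have [le_pm|lt_mp] := leqP p m; last first.
  exists 0 => [|j]; first exact: shom0.
  have := hW j; rewrite /shom leqNgt lt_mp /= => /eqP ->.
  rewrite mulr0 subr0; rewrite -(mulr0 (h ^+ 1)); exact: in_colon_hX.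
have {}hW j : W j \is (m - p).-homog by have := hW j; rewrite /shom le_pm.
have [i j|w0 hw0 Ew0] := koszul_exact (leq_subr p m) hW; last first.
- exists w0 => //; move: hw0; rewrite /shom.
  by rewrite subn_gt0 -subnDA addn1.
have Ez : in_mcolon p p.+2 (l j * (l i * f - h ^+ p.+1 * W i)
    - l i * (l j * f - h ^+ p.+1 * W j)).
  by apply: in_mcolonB; apply: in_mcolonM.
have zE : l j * (l i * f - h ^+ p.+1 * W i) - l i * (l j * f - h ^+ p.+1 * W j)
  = h ^+ p.+1 * (l i * W j - l j * W i) by ring.
(* For [p = 0] the power of [h] is cancelled at once. Otherwise multiplication by [l] spends one
   power of the maximal ideal, and [socle_free_iter] removes the others. *)
case: p => [|p] in p0 hw Ef Ef' Ew W hW EW le_pm Ez zE *.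
  by apply: (@in_colon_cancel 1 1); rewrite -zE.
have hz : l i * W j - l j * W i \is (1 + (m - p.+1)).-homog.
  by apply: rpredB; apply: dhomogM.
apply: (socle_free_iter _ hz (q := p)).
  by rewrite add1n addSn ltnS addnBAC // leq_subLR addSn addnC ltnW // ltnS leq_addl.
apply: (@in_mcolon_cancel p 1 p.+2); rewrite -zE addn1.
by apply: in_mcolonB; apply: in_mcolon_l.
Qed.

(** By induction on [p]: [f' j] satisfies the hypothesis on [f] one step lower, and the correction
    found for it is the [w j] that [descent_core] requires. At [p = 0] the choice [w = f'] makes
    that requirement trivial. *)
Lemma descent_step p f : (p < P)%N -> f \is m.-homog -> in_mcolon p p.+1 f ->
  exists2 w, shom m p.+1 w & in_mcolon p.+1 p.+2 (f - h ^+ p.+1 * w).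
Proof.
elim: p f => [|p IHp] f ltpP hf Ef;
  have /fin_all_exists2 [f' hf' Ef'] := tangent ltpP hf Ef.
  apply: (descent_core (f' := f') (w := f')) => // j.
    by rewrite shom_homog.
  rewrite expr0 mul1r subrr -(mulr0 (h ^+ 1)); exact: in_colon_hX.
suff /fin_all_exists2 [w hw Ew] : forall j, exists2 w, shom m p.+1 w &
    in_mcolon p.+1 p.+2 (f' j - h ^+ p.+1 * w).
  exact: (descent_core (f' := f') (w := w)).
move=> j; apply: IHp => //; first exact: ltnW.
(* It suffices to treat [h * f' j], the tangent relation minus a multiple of [l j * f]; the former
   is brought down one step by multiplying by [h] and cancelling that factor. *)
apply: (in_mcolon_cancel (k := 1)); rewrite expr1 add1n.
have -> : h * f' j = (h * f' j + p.+2%:R *: (l j * f)) - p.+2%:R *: (l j * f).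
  by rewrite addrK.
apply: in_mcolonB; last by apply/in_mcolonZ/in_mcolon_l.
by apply: (in_mcolon_cancel (k := 1)); rewrite expr1 add1n; apply: in_mcolon_h.
Qed.

Lemma descent p f : (p <= P)%N -> f \is m.-homog -> in_colon 1 f ->
  exists2 fp, fp \is m.-homog &
    in_mcolon p p.+1 fp /\ exists r, fp = f - h * r.
Proof.
move=> + hf Ef; elim: p => [|p IHp] lepP.
  by exists f => //; split=> //; exists 0; rewrite mulr0 subr0.
have [fp hfp [Efp [r fpE]]] := IHp (ltnW lepP).
have [w hw Ew] := descent_step lepP hfp Efp.
exists (fp - h ^+ p.+1 * w).
  apply: rpredB => //; rewrite mulrC; apply: (shomM hw).
  by have := dhomogMn p.+1 h_homog; rewrite mul1n.
by split=> //; exists (r + h ^+ p * w); rewrite fpE exprS; ring.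
Qed.

End Descent.

(** * Growth of the coordinate ring *)

Lemma hcompE n d (p : CPoly n) : hcomp d p = pihomog mdeg d p.
Proof. by []. Qed.

Lemma mpoly_ring_ind n (P : CPoly n -> Prop) :
    (forall c, P c%:MP) -> (forall p q, P p -> P q -> P (p + q)) ->
    (forall p q, P p -> P q -> P (p * q)) -> (forall i, P 'X_i) ->
  forall p, P p.
Proof.
move=> PC PD PM PX p; rewrite [p]mpolyE.
elim/big_ind: _ => [|q1 q2|m _]; [exact: (PC 0) | exact: PD |].
rewrite -mul_mpolyC; apply: (PM) => //; rewrite mpolyXE_id.
elim/big_ind: _ => [|q1 q2|i _]; [exact: (PC 1) | exact: PM |].
by elim: (m i) => [|k IHk]; [exact: (PC 1) | rewrite exprS; apply: PM].
Qed.

Lemma ideal_cong n (J K : CPoly n -> Prop) : is_ideal J ->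
    (forall c, K c%:MP) ->
    (forall s t, K s -> K t -> K (s + t)) ->
    (forall s t, K s -> K t -> K (s * t)) ->
    (forall i, exists2 s, K s & J ('X_i - s)) ->
  forall p, exists2 s, K s & J (p - s).
Proof.
move=> iJ KC KD KM KX p.
elim/mpoly_ring_ind: p => [c|p q [s Ks Js] [t Kt Jt]|p q [s Ks Js] [t Kt Jt]|//].
- by exists c%:MP => //; rewrite subrr; exact: ideal0.
- by exists (s + t); [exact: KD | rewrite opprD addrACA; exact: idealD].
- exists (s * t); first exact: KM.
  have -> : p * q - s * t = q * (p - s) + s * (q - t) by ring.
  by apply: idealD => //; exact: idealM.
Qed.

(** Over an algebraically closed field [q] splits, and a prime ideal containing the product contains
    one of the linear factors at [t]. *)
Lemma poly_in_prime n (I : CPoly n -> Prop) (t : CPoly n) (q : {poly CC}) :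
  is_prime_ideal I -> q != 0 -> I (map_poly (@mpolyC n CC) q).[t] ->
  exists r, I (t - r%:MP).
Proof.
move=> [iI nI1 pI]; move: {2}(size q) (leqnn (size q)) => k.
elim: k q => [|k IHk] q; first by rewrite leqn0 size_poly_eq0 => /eqP ->; rewrite eqxx.
move=> le_k q0 Iq.
have [sz1|sz1] := eqVneq (size q) 1.
  case: nI1; move/eqP: sz1 => /size_poly1P [c c0 qE].
  move: Iq; rewrite qE map_polyC hornerC => /(idealZ c^-1 iI).
  by rewrite -mul_mpolyC -mpolyCM mulVf // mpolyC1.
have /closed_rootP [r /factor_theorem [q' qE]] := sz1.
move: Iq; rewrite qE rmorphM hornerM /= rmorphB /= map_polyX map_polyC /=.
rewrite hornerXsubC => /pI [Iq'|]; last by exists r.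
have q'0 : q' != 0 by apply: contraNneq q0 => q'0; rewrite qE q'0 mul0r.
apply: (IHk q') => //; move: le_k.
by rewrite qE size_Mmonic ?monicXsubC // size_XsubC addn2.
Qed.

(** Otherwise a single variable ['X_k] generates the quotient by [I]. An element of [P1] outside [I]
    is then a nonzero polynomial relation on ['X_k], so the quotient by [P1] consists of constants
    and [P1] is maximal, against [P1 < P2]. *)
Lemma two_independent_variables (I : CPoly 4 -> Prop) : is_curve_ideal I ->
  exists s k : 'I_4, ~ I 'X_k /\ forall r, ~ I ('X_s - r *: 'X_k).
Proof.
case=> [_ pI [[P1 [P2 [pP1 pP2 [IP1 [p1 [P1p1 nIp1]]] [P12 [p2 [P2p2 nP1p2]]]]]] _]].
have iI : is_ideal I by case: pI.
have iP1 : is_ideal P1 by case: pP1.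
have iP2 : is_ideal P2 by case: pP2.
apply: NNPP => noind.
have [k /fin_all_exists [c cP]] : exists k : 'I_4, forall i : 'I_4, exists c,
    I ('X_i - c *: 'X_k).
  have [[k nIk]|allI] := classic (exists k : 'I_4, ~ I 'X_k).
    exists k => i; apply: NNPP => nI; apply: noind; exists i, k; split=> // r Ir.
    by apply: nI; exists r.
  exists ord0 => i; exists 0; rewrite scale0r subr0; apply: NNPP => nI.
  by apply: allI; exists i.
have [r P1r] : exists r, P1 ('X_k - r%:MP).
  have [|s t [q1 ->] [q2 ->]|s t [q1 ->] [q2 ->]|i|_ [q ->] Iq] :=
    @ideal_cong _ I (fun s => exists q, s = (map_poly (@mpolyC 4 CC) q).['X_k])
      iI _ _ _ _ p1.
  - by move=> e; exists e%:P; rewrite map_polyC hornerC.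
  - by exists (q1 + q2); rewrite rmorphD hornerD.
  - by exists (q1 * q2); rewrite rmorphM hornerM.
  - exists (c i *: 'X_k); last exact: cP.
    by exists (c i *: 'X); rewrite map_polyZ map_polyX hornerZ hornerX mul_mpolyC.
  apply: (poly_in_prime (q := q) pP1).
    apply/eqP => q0; apply: nIp1; move: Iq.
    by rewrite q0 rmorph0 horner0 subr0.
  by have := idealB iP1 P1p1 (IP1 _ Iq); rewrite subKr.
have [|s t [e1 ->] [e2 ->]|s t [e1 ->] [e2 ->]|i|_ [e ->] P1e] :=
  @ideal_cong _ P1 (fun s => exists e, s = e%:MP) iP1 _ _ _ _ p2.
- by move=> e; exists e.
- by exists (e1 + e2); rewrite mpolyCD.
- by exists (e1 * e2); rewrite mpolyCM.
- exists (c i * r)%:MP; first by exists (c i * r).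
  have -> : 'X_i - (c i * r)%:MP =
      ('X_i - c i *: 'X_k) + c i *: ('X_k - r%:MP) :> CPoly 4.
    by rewrite scalerBr mpolyCM mul_mpolyC; ring.
  by apply: idealD => //; [exact: IP1 | exact: idealZ].
case: pP2 => _ nP21 _; apply: nP21.
have e0 : e != 0.
  by apply/eqP => e0; apply: nP1p2; move: P1e; rewrite e0 mpolyC0 subr0.
have := idealB iP2 P2p2 (P12 _ P1e); rewrite subKr => /(idealZ e^-1 iP2).
by rewrite -mul_mpolyC -mpolyCM mulVf // mpolyC1.
Qed.

(** A binary form splits into linear factors, each proportional to [V] or to some [U - r *: V]; the
    factor [V] appears when [q] has degree less than [p]. *)
Lemma binary_form_notin n (I : CPoly n -> Prop) (U V : CPoly n) :
    is_prime_ideal I -> ~ I V -> (forall r, ~ I (U - r *: V)) ->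
  forall p (q : {poly CC}), q != 0 -> (size q <= p.+1)%N ->
  ~ I (\sum_(i < p.+1) q`_i *: (U ^+ i * V ^+ (p - i))).
Proof.
move=> [iI nI1 pI] nV nU; elim=> [|p IHp] q q0 le_q Iq.
  apply: nI1; move: Iq; rewrite big_ord1 !expr0 mulr1.
  have /size_poly1P [c c0 ->] : size q == 1.
    by rewrite eqn_leq le_q lt0n size_poly_eq0.
  rewrite coefC /= => /(idealZ c^-1 iI).
  by rewrite scalerA mulVf // scale1r.
have [le_qp|lt_pq] := leqP (size q) p.+1.
  apply: (IHp q q0 le_qp).
  move: Iq; rewrite big_ord_recr /= nth_default // scale0r addr0.
  have -> : \sum_(i < p.+1) q`_i *: (U ^+ i * V ^+ (p.+1 - i)) =
      V * \sum_(i < p.+1) q`_i *: (U ^+ i * V ^+ (p - i)).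
    rewrite mulr_sumr; apply: eq_bigr => i _.
    by rewrite subSn ?leq_ord // exprS -scalerAr mulrCA.
  by case/pI.
have /closed_rootP [r /factor_theorem [q' qE]] : size q != 1.
  by apply: contraTneq lt_pq => ->.
have q'0 : q' != 0 by apply: contraNneq q0 => q'0; rewrite qE q'0 mul0r.
have szq' : (size q' <= p.+1)%N.
  by move: le_q; rewrite qE size_Mmonic ?monicXsubC // size_XsubC addn2.
apply: (IHp q' q'0 szq').
move: Iq; have -> : \sum_(i < p.+2) q`_i *: (U ^+ i * V ^+ (p.+1 - i)) =
   (U - r *: V) * \sum_(i < p.+1) q'`_i *: (U ^+ i * V ^+ (p - i)).
  have q'p : q'`_p.+1 = 0 by rewrite nth_default.
  have coefq i : q`_i = (if i is i'.+1 then q'`_i' else 0) - r * q'`_i.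
    by rewrite qE mulrBr coefB coefMX coefMC mulrC; case: i.
  under eq_bigr => i _ do rewrite coefq scalerBl.
  rewrite sumrB mulrBl; congr (_ - _).
    rewrite big_ord_recl /= scale0r add0r mulr_sumr; apply: eq_bigr => i _.
    by rewrite /bump /= add1n subSS exprS -scalerAr mulrA.
  rewrite big_ord_recr /= q'p mulr0 scale0r addr0 mulr_sumr.
  apply: eq_bigr => i _; rewrite subSn ?leq_ord // exprS -scalerA.
  by rewrite -scalerAl -scalerAr mulrCA.
by case/pI => // /nU.
Qed.

Section Growth.
Variables (I : CPoly 4 -> Prop) (h h' : CPoly 4) (a m : nat).
Hypothesis homI : is_homog_ideal I.
Hypothesis primeI : is_prime_ideal I.
Hypothesis h_homog : h \is 1.-homog.
Hypothesis h'_homog : h' \is 1.-homog.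
Hypothesis h'_notin : ~ I h'.
Variables s k : 'I_4.
Hypothesis Xk_notin : ~ I 'X_k.
Hypothesis Xs_indep : forall r, ~ I ('X_s - r *: 'X_k).

Lemma in_mcolon_binary q i j G : in_mcolon I h h' a (i + j) q G ->
  in_colon I h h' a q ('X_s ^+ i * 'X_k ^+ j * G).
Proof.
elim: i G => [|i IHi] G /=.
  elim: j G => [|j IHj] G /=; first by rewrite !expr0 !mul1r.
  by move=> /(_ k) /IHj; rewrite !mul1r exprSr mulrA.
by move=> /(_ s) /IHi; rewrite exprSr; congr (in_colon _ _ _ _ _ _); ring.
Qed.

(** The [p.+1] products ['X_s ^+ i * 'X_k ^+ (p - i) * f] have quotients [g i] of degree
    [(a + m).-1], a space of dimension at most [p]. A linear relation between the [g i] gives a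
    nonzero binary form [B] with [h' ^+ a * (B * f)] in [I]; neither [h'] nor [B] is in the prime
    [I], so [f] is. *)
Lemma growth_contradiction p f : (0 < a)%N -> (#|{: 'X_{1..4 < a + m}}| <= p)%N ->
  f \is m.-homog -> in_mcolon I h h' a p p.+1 f -> I f.
Proof.
move=> a_gt0 le_p hf Ef; have iI : is_ideal I by case: primeI.
have /fin_all_exists2 [g hg gP] : forall i : 'I_p.+1,
    exists2 g, g \is (a + m).-1.-homog &
      I (h' ^+ a * ('X_s ^+ i * 'X_k ^+ (p - i) * f) - g * h ^+ p.+1).
  move=> i; have le_ip : (i <= p)%N by rewrite -ltnS.
  have [|r Ir] := @in_mcolon_binary p.+1 i (p - i) f; first by rewrite subnKC.
  exists (pihomog mdeg (a + m).-1 r); first exact: pihomogP.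
  have := homI.2 _ (a + (p + m))%N Ir; rewrite hcompE linearB /=.
  have hu : h' ^+ a * ('X_s ^+ i * 'X_k ^+ (p - i) * f) \is (a + (p + m)).-homog.
    apply: dhomogM; first by have := dhomogMn a h'_homog; rewrite mul1n.
    apply: dhomogM => //; rewrite -[p in X in _ \is X](subnKC le_ip).
    apply: dhomogM.
      by have := dhomogMn i (mpolyXU_homog CC s); rewrite mul1n.
    by have := dhomogMn (p - i) (mpolyXU_homog CC k); rewrite mul1n.
  rewrite (pihomog_dE hu) [h ^+ _ * r]mulrC.
  have hh : h ^+ p.+1 \is (p.+1).-homog by have := dhomogMn p.+1 h_homog; rewrite mul1n.
  have lt_p : (p < a + (p + m))%N by rewrite addnCA -{1}[p]addn0 ltn_add2l addn_gt0 a_gt0.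
  have -> : (a + m).-1 = (a + (p + m) - p.+1)%N by rewrite addnCA subnS addKn.
  by rewrite (pihomogM _ _ hh) lt_p.
pose M := \matrix_(i < p.+1, j < #|{: 'X_{1..4 < a + m}}|)
  (g i)@_(enum_val j : 'X_{1..4 < a + m}).
have : kermx M != 0.
  rewrite kermx_eq0 /row_free; apply/eqP => rkM.
  by have := rank_leq_col M; rewrite rkM => /(leq_trans) /(_ le_p); rewrite ltnn.
case/rowV0Pn => c /sub_kermxP cM c0.
have cg0 : \sum_i c 0 i *: g i = 0.
  apply/mpolyP => mo; rewrite mcoeff0 linear_sum /=.
  under eq_bigr => i _ do rewrite linearZ /=.
  have [lt_mo|ge_mo] := ltnP (mdeg mo) (a + m).
    have := congr1 (fun A : 'rV_ _ => A 0 (enum_rank (BMultinom lt_mo))) cM.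
    rewrite !mxE => cMj; rewrite -[RHS]cMj; apply: eq_bigr => i _.
    by rewrite mxE enum_rankK.
  rewrite big1 // => i _; rewrite (dhomog_nemf_coeff (hg i)) ?mulr0 //=.
  by apply: contraTneq ge_mo => ->; rewrite -ltnNge prednK // addn_gt0 a_gt0.
pose q := \poly_(i < p.+1) c 0 (inord i).
have q0 : q != 0.
  apply: contraNneq c0 => q0; apply/eqP/rowP => i; rewrite mxE.
  by have := coef_poly p.+1 (fun i => c 0 (inord i)) i; rewrite -/q q0 coef0 ltn_ord inord_val.
have [_ _ pI] := primeI.
have nq := binary_form_notin primeI Xk_notin Xs_indep q0 (size_poly _ _).
set B := \sum_(i < p.+1) _ in nq.
have IB : I (h' ^+ a * (B * f)).
  have : I (\sum_i c 0 i *: (h' ^+ a * ('X_s ^+ i * 'X_k ^+ (p - i) * f) - g i * h ^+ p.+1)).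
    by apply: ideal_sum => // i _; apply: idealZ.
  congr I; under eq_bigr => i _ do rewrite scalerBr.
  rewrite sumrB.
  have -> : \sum_(i < p.+1) c 0 i *: (g i * h ^+ p.+1) = (\sum_i c 0 i *: g i) * h ^+ p.+1.
    by rewrite mulr_suml; apply: eq_bigr => i _; rewrite scalerAl.
  rewrite cg0 mul0r subr0 /B mulr_suml mulr_sumr; apply: eq_bigr => i _.
  by rewrite coef_poly ltn_ord inord_val -scalerAl -scalerAr.
by have /pI [/nq|] := primeX primeI h'_notin IB.
Qed.

End Growth.

(** * Generic points *)

(** By induction on the number of variables: at a point where the leading coefficient in the last
    variable is nonzero, a nonzero polynomial in that variable remains. *)
Lemma mpoly_nonroot (F : closedFieldType) n (p : {mpoly F[n]}) :
  p != 0 -> exists v, p.@[v] != 0.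
Proof.
elim: n p => [|n IHn] p p0.
  exists (fun=> 0); move: p0; have -> : p = (p@_0)%:MP.
    apply/mpolyP => m; rewrite mcoeffC (_ : m = 0%MM) ?eqxx ?mulr1 //.
    by apply/mnmP; case.
  by rewrite mevalC mpolyC_eq0.
have q0 : muni p != 0.
  (* A monomial is determined by its restriction to the first [n] variables and its last exponent,
     so no other monomial cancels the leading one in [muni p]. *)
  pose r (m : 'X_{1..n.+1}) := [multinom m (widen_ord (leqnSn n) i) | i < n].
  have r_inj m m' : r m = r m' -> m ord_max = m' ord_max -> m = m'.
    move=> rE mE; apply/mnmP => i.
    have [->|i_max] := eqVneq i ord_max; first exact: mE.
    have lt_i : (i < n)%N.
      by rewrite ltn_neqAle -ltnS ltn_ord andbT; apply: contraNneq i_max => iE; apply/eqP/val_inj.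
    have := congr1 (fun m : 'X_{1..n} => m (Ordinal lt_i)) rE.
    by rewrite !mnmE; congr (m _ = m' _); apply: val_inj.
  apply/eqP => /(congr1 (fun q : {poly _} => (q`_(mlead p ord_max))@_(r (mlead p)))).
  rewrite coef0 mcoeff0 muniE coef_sum linear_sum /= (bigD1_seq (mlead p)) ?mlead_supp ?msupp_uniq //=.
  rewrite coefZ coefXn eqxx mulr1 mcoeffZ mcoeffX eqxx mulr1 big1 ?addr0.
    by move/eqP; rewrite mleadc_eq0; apply/negP.
  move=> m ne_m; rewrite coefZ coefXn; have [mE|] := eqVneq; last by rewrite mulr0 mcoeff0.
  rewrite mulr1 mcoeffZ mcoeffX; case: eqP => [rE|]; last by rewrite mulr0.
  by case/eqP: ne_m; apply: r_inj.
have [v v0] := IHn (lead_coef (muni p)) ltac:(by rewrite lead_coef_eq0).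
have /closed_nonrootP [t t0] : map_poly (meval v) (muni p) != 0.
  apply: contraNneq v0 => /(congr1 (fun q : {poly F} => q`_(size (muni p)).-1)).
  by rewrite coef_map coef0 /= lead_coefE => ->.
pose w (i : 'I_n.+1) := if insub (val i) is Some j then v j else t.
exists w; apply: contraNneq t0 => pw; rewrite rootE -pw; apply/eqP.
rewrite muniE rmorph_sum horner_sum mevalE; apply: eq_bigr => m _ /=.
rewrite map_polyZ hornerZ map_polyXn hornerXn /= mevalZ mevalX -mulrA; congr (_ * _).
rewrite big_ord_recr /= {2}/w insubN ?ltnn //; congr (_ * _).
by apply: eq_bigr => i _; rewrite mnmE /w /= valK.
Qed.

(** Write [M(s)] for the deformed matrix and suppose that [u *m M1] is independent of a basis
    [D *m M0] of the row space of [M0]. For [s != 0] the rows of [D *m M(s)] and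
    [s^-1 *: (u *m M(s))] lie in the row space of [M(s)]; at [s = 0] they extend to an independent
    family, so they are independent for almost all [s], and the rank exceeds that of [M0]. *)
Lemma mxrank_deformation (F : closedFieldType) m n (M0 M1 : 'M[F]_(m, n))
    (M2 : 'M[{poly F}]_(m, n)) (u : 'rV_m) :
    (forall s, (\rank (M0 + s *: M1 + s ^+ 2 *: map_mx (horner_eval s) M2)%R
                <= \rank M0)%N) ->
  u *m M0 = 0 -> (u *m M1 <= M0)%MS.
Proof.
move=> rkM uM0; apply: contraT => nsub; set y := u *m M1 in nsub.
have /submxP [D DE] : (row_base M0 <= M0)%MS by rewrite eq_row_base.
have free0 : row_free (col_mx (D *m M0) y).
  have lt_y : (row_base M0 < row_base M0 + y)%MS.
    by rewrite /ltmx addsmxSl /= addsmx_sub submx_refl /= eq_row_base.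
  have := rank_ltmx lt_y; rewrite eq_row_base => lt_rk.
  by rewrite /row_free eqn_leq rank_leq_row -DE -addsmxE addn1.
pose Y := pinvmx (col_mx (D *m M0) y).
pose Mp : 'M[{poly F}]_(m, n) := map_mx polyC M0 + 'X *: map_mx polyC M1 + 'X ^+ 2 *: M2.
pose K := col_mx (map_mx polyC D *m Mp)
  (map_mx polyC y + 'X *: (map_mx polyC u *m M2)).
have MpE s : map_mx (horner_eval s) Mp =
    M0 + s *: M1 + s ^+ 2 *: map_mx (horner_eval s) M2.
  by apply/matrixP => i j; rewrite !mxE /= /horner_eval !hornerE.
have mapC k l s (A : 'M[F]_(k, l)) : map_mx (horner_eval s) (map_mx polyC A) = A.
  by apply/matrixP => i j; rewrite !mxE /= /horner_eval hornerC.
have KE s : map_mx (horner_eval s) K =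
    col_mx (D *m (M0 + s *: M1 + s ^+ 2 *: map_mx (horner_eval s) M2))
           (y + s *: (u *m map_mx (horner_eval s) M2)).
  rewrite map_col_mx map_mxM mapC MpE map_mxD mapC; congr (col_mx _ (_ + _)).
  rewrite -{2}(mapC _ _ s u) -map_mxM.
  by apply/matrixP => i j; rewrite !mxE /= /horner_eval !hornerE.
pose f := \det (K *m map_mx polyC Y).
have fE s : f.[s] = \det (map_mx (horner_eval s) K *m Y).
  by rewrite -[LHS]/(horner_eval s f) -det_map_mx map_mxM mapC.
(* The factor ['X] excludes [s = 0], where [y] is outside the row space. *)
have f0 : 'X * f != 0.
  rewrite mulf_eq0 polyX_eq0 /=; apply/eqP => /(congr1 (horner_eval 0)) /=.
  rewrite /horner_eval fE KE !scale0r expr0n /= scale0r !addr0 mulmxVp // det1 horner0.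
  by move/eqP; rewrite oner_eq0.
have /closed_nonrootP [s] := f0; rewrite rootE hornerM hornerX mulf_eq0 negb_or.
case/andP => s0; rewrite fE KE => det0.
pose Ms := M0 + s *: M1 + s ^+ 2 *: map_mx (horner_eval s) M2.
suff : (\rank M0 + 1 <= \rank Ms)%N.
  by move/leq_trans => /(_ _ (rkM s)); rewrite addn1 ltnn.
rewrite -/Ms in det0.
have Ksub : (col_mx (D *m Ms) (y + s *: (u *m map_mx (horner_eval s) M2)) <= Ms)%MS.
  rewrite -addsmxE addsmx_sub submxMl /=; apply/submxP; exists (s^-1 *: u).
  rewrite /Ms !mulmxDr -!scalemxAl uM0 scaler0 add0r -!scalemxAr !scalerA.
  by rewrite expr2 mulrA mulVf // scale1r mul1r.
apply: leq_trans _ (mxrankS Ksub).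
apply: leq_trans _ (mxrankM_maxl _ Y); rewrite mxrank_unit //.
by rewrite unitmxE unitfE.
Qed.

Lemma subspace_mx (F : fieldType) n (V : 'rV[F]_n -> Prop) :
    V 0 -> (forall u v, V u -> V v -> V (u + v)) ->
    (forall c u, V u -> V (c *: u)) ->
  exists W : 'M_n, forall u, (u <= W)%MS <-> V u.
Proof.
move=> V0 VD VZ.
(* Either [V] is already a row space or it contains one of dimension [k]; at [k = n] the latter is
   everything. *)
suff H k : (k <= n)%N -> (exists W : 'M_n, forall u, (u <= W)%MS <-> V u) \/
    exists W : 'M_n, (forall u, (u <= W)%MS -> V u) /\ \rank W = k.
  have [//|[W [WV rkW]]] := H n (leqnn n); exists W => u; split; first exact: WV.
  by move=> _; apply: submx_full; rewrite /row_full rkW.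
elim: k => [|k IHk] le_k.
  right; exists 0; split; last exact: mxrank0.
  by move=> u; rewrite submx0 => /eqP ->.
have [|[W [WV rkW]]] := IHk (ltnW le_k); first by left.
have [full|/not_all_ex_not [v nv]] := classic (forall u, V u -> (u <= W)%MS).
  by left; exists W => u; split; [exact: WV | exact: full].
have [Vv /negP nWv] := imply_to_and _ _ nv; right; exists (W + v)%MS; split.
  move=> u /sub_addsmxP [[w c] /= ->]; apply: VD; first by apply: WV; exact: submxMl.
  by rewrite [c]mx11_scalar mul_scalar_mx; exact: VZ.
apply/eqP; rewrite eqn_leq; apply/andP; split.
  by apply: leq_trans (mxrank_adds_leqif _ _) _; rewrite rkW -[k.+1]addn1 leq_add2l rank_leq_row.
rewrite -rkW; apply: rank_ltmx; rewrite /ltmx addsmxSl /= addsmx_sub negb_and.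
by rewrite nWv orbT.
Qed.

Lemma bounded_nat_max (T : Type) (f : T -> nat) b (x : T) :
  (forall y, f y <= b)%N -> exists y, forall z, (f z <= f y)%N.
Proof.
move=> fb; suff H k : forall y, (b - f y <= k)%N -> exists y, forall z, (f z <= f y)%N.
  exact: (H _ x).
elim: k => [|k IHk] y le_k.
  by exists y => z; apply: leq_trans (fb z) _; rewrite -subn_eq0 -leqn0.
have [ymax|/not_all_ex_not [z /negP]] := classic (forall z, (f z <= f y)%N).
  by exists y.
rewrite -ltnNge => lt_yz; apply: (IHk z); rewrite -ltnS; apply: leq_trans le_k.
by rewrite ltn_sub2l // (leq_trans lt_yz).
Qed.

(** * Polynomial functions of a parameter and generic properties *)

Section Generic.
Variables (T : Type) (N : nat) (pt : T -> 'I_N -> CC).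

Definition polyfun (f : T -> CC) : Prop :=
  exists Q : CPoly N, forall t, f t = Q.@[pt t].

Definition generic (Pr : T -> Prop) : Prop :=
  exists Q : CPoly N, Q != 0 /\ forall t, Q.@[pt t] != 0 -> Pr t.

Lemma generic_and (P1 P2 : T -> Prop) :
  generic P1 -> generic P2 -> generic (fun t => P1 t /\ P2 t).
Proof.
move=> [Q1 [Q10 H1]] [Q2 [Q20 H2]]; exists (Q1 * Q2); split.
  by rewrite mulf_neq0.
by move=> t; rewrite mevalM mulf_eq0 negb_or => /andP [/H1 ? /H2 ?].
Qed.

Lemma generic_imp (P1 P2 : T -> Prop) :
  (forall t, P1 t -> P2 t) -> generic P1 -> generic P2.
Proof. by move=> P12 [Q [Q0 H]]; exists Q; split=> // t /H /P12. Qed.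

Lemma generic_all_lt (Pr : nat -> T -> Prop) k :
  (forall i, generic (Pr i)) -> generic (fun t => forall i, (i < k)%N -> Pr i t).
Proof.
move=> H; elim: k => [|k IHk].
  by exists 1; split=> //; rewrite oner_eq0.
apply: generic_imp (generic_and IHk (H k)) => t [Pt Pk] i.
by rewrite ltnS leq_eqVlt => /orP [/eqP -> | /Pt].
Qed.

Lemma polyfun_generic f t : polyfun f -> f t != 0 -> generic (fun t => f t != 0).
Proof.
move=> [Q fE] ft0; exists Q; split; last by move=> u; rewrite fE.
by apply: contraNneq ft0 => Q0; rewrite fE Q0 meval0.
Qed.

Lemma polyfun_cst c : polyfun (fun=> c).
Proof. by exists c%:MP => t; rewrite mevalC. Qed.

Lemma polyfunM f g : polyfun f -> polyfun g -> polyfun (fun t => f t * g t).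
Proof. by move=> [Q fE] [Q' gE]; exists (Q * Q') => t; rewrite mevalM fE gE. Qed.

Lemma polyfunN f : polyfun f -> polyfun (fun t => - f t).
Proof. by move=> [Q fE]; exists (- Q) => t; rewrite mevalN fE. Qed.

Lemma polyfun_sum (J : Type) (r : seq J) (f : J -> T -> CC) :
  (forall j, polyfun (f j)) -> polyfun (fun t => \sum_(j <- r) f j t).
Proof.
move=> pf; elim: r => [|j r [Q QE]].
  by exists 0 => t; rewrite big_nil meval0.
have [Q' Q'E] := pf j; exists (Q' + Q) => t.
by rewrite big_cons mevalD -QE -Q'E.
Qed.

Lemma polyfun_det k (B : T -> 'M[CC]_k) :
  (forall i j, polyfun (fun t => B t i j)) -> polyfun (fun t => \det (B t)).
Proof.
move=> pB; have /fin_all_exists [Q QE] : forall ij : 'I_k * 'I_k,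
  exists Q : CPoly N, forall t, B t ij.1 ij.2 = Q.@[pt t] by move=> ij; exact: pB.
exists (\det (\matrix_(i, j) Q (i, j))) => t; rewrite -det_map_mx; congr (\det _).
by apply/matrixP => i j; rewrite !mxE (QE (i, j)).
Qed.

(** At a parameter [t1] of maximal rank, one-sided inverses [X] and [Y] of the factors of a rank
    decomposition compress [B t1] to an identity matrix. The determinant of [X *m B t *m Y] is
    polynomial in [t], and the rank is maximal wherever it is nonzero. *)
Lemma generic_rank k l (t0 : T) (B : T -> 'M[CC]_(k, l)) :
    (forall i j, polyfun (fun t => B t i j)) ->
  generic (fun t => forall t', (\rank (B t') <= \rank (B t))%N).
Proof.
move=> pB; have [t1 max_t1] := bounded_nat_max t0 (fun t => rank_leq_row (B t)).
pose X := pinvmx (col_base (B t1)); pose Y := pinvmx (row_base (B t1)).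
have pf : polyfun (fun t => \det (X *m B t *m Y)).
  apply: polyfun_det => i j.
  have [Q QE] : polyfun (fun t => \sum_b (\sum_c X i c * B t c b) * Y b j).
    apply: polyfun_sum => b; apply: polyfunM; last exact: polyfun_cst.
    by apply: polyfun_sum => c; apply: polyfunM => //; exact: polyfun_cst.
  exists Q => t; rewrite -QE mxE; apply: eq_bigr => b _; by rewrite mxE.
have : \det (X *m B t1 *m Y) != 0.
  have -> : X *m B t1 = X *m (col_base (B t1) *m row_base (B t1)).
    by rewrite mulmx_base.
  by rewrite mulmxA mulVpmx ?col_base_full // mul1mx mulmxVp ?row_base_free // det1 oner_eq0.
move/(polyfun_generic pf); apply: generic_imp => t det0 t'.
apply: leq_trans (max_t1 t') _.
apply: leq_trans _ (mxrankM_maxr X _); apply: leq_trans _ (mxrankM_maxl _ Y).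
by rewrite mxrank_unit // unitmxE unitfE.
Qed.

Definition polyfam n (q : T -> CPoly n) : Prop :=
  exists G : {mpoly (CPoly N)[n]}, forall t, q t = map_mpoly (meval (pt t)) G.

Lemma polyfam_coef n (q : T -> CPoly n) m : polyfam q -> polyfun (fun t => (q t)@_m).
Proof. by move=> [G qE]; exists G@_m => t; rewrite qE mcoeff_map_mpoly. Qed.

Lemma polyfam_cst n (q : CPoly n) : polyfam (fun=> q).
Proof.
exists (map_mpoly (@mpolyC N CC) q) => t; apply/mpolyP => m.
by rewrite !mcoeff_map_mpoly /= mevalC.
Qed.

Lemma polyfamM n (q1 q2 : T -> CPoly n) :
  polyfam q1 -> polyfam q2 -> polyfam (fun t => q1 t * q2 t).
Proof.
by move=> [G1 E1] [G2 E2]; exists (G1 * G2) => t; rewrite rmorphM E1 E2.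
Qed.

Lemma polyfamN n (q : T -> CPoly n) : polyfam q -> polyfam (fun t => - q t).
Proof. by move=> [G E]; exists (- G) => t; rewrite rmorphN E. Qed.

Lemma polyfamX n (q : T -> CPoly n) k : polyfam q -> polyfam (fun t => q t ^+ k).
Proof. by move=> [G E]; exists (G ^+ k) => t; rewrite rmorphXn E. Qed.

Lemma polyfam_linear n (c : T -> 'I_n -> CC) :
  (forall i, polyfun (c^~ i)) -> polyfam (fun t => \sum_i c t i *: 'X_i).
Proof.
move=> /fin_all_exists [Q QE]; exists (\sum_i Q i *: 'X_i) => t.
by rewrite rmorph_sum; apply: eq_bigr => i _ /=; rewrite map_mpolyZ map_mpolyX QE.
Qed.

End Generic.

(** * First-order deformations *)

(** The second-order remainder is an explicit polynomial in [s] with coefficients free of [s], as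
    [mxrank_deformation] requires. *)
Lemma expr_line (R : comNzRingType) (A : comAlgType R) (h L : A) p :
  exists c : 'I_p -> A, forall s : R, (h + s *: L) ^+ p.+1 =
    h ^+ p.+1 + s *: (p.+1%:R *: (L * h ^+ p)) +
    s ^+ 2 *: \sum_(i < p) s ^+ i *: c i.
Proof.
exists (fun i => (h ^+ (p - i.+1) * L ^+ i.+2) *+ 'C(p.+1, i.+2)) => s.
rewrite exprDn !big_ord_recl /= subn0 expr0 mulr1 bin0 mulr1n.
rewrite [bump 0 0]/= subSS subn0 expr1 bin1 -addrA; congr (_ + (_ + _)).
  by rewrite -scalerAr scaler_nat mulrC -scalerMnr.
rewrite scaler_sumr; apply: eq_bigr => i _; rewrite /bump /= !add1n subSS.
by rewrite exprZn -scalerAr scalerA -exprD add2n scalerMnr.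
Qed.

Lemma homog_msize n (F : nzRingType) d (q : {mpoly F[n]}) :
  q \is d.-homog -> (msize q <= d.+1)%N.
Proof.
move/dhomogP => hq; rewrite msizeE; apply/bigmax_leqP_seq => m mq _.
by rewrite (hq m mq).
Qed.

Section Tangent.
Variables (T : Type) (N : nat) (pt : T -> 'I_N -> CC) (t0 : T).
Variables (I : CPoly 4 -> Prop) (h h' : T -> CPoly 4) (a p m : nat).
Hypothesis homI : is_homog_ideal I.
Hypothesis polyfam_h : polyfam pt h.
Hypothesis polyfam_h' : polyfam pt h'.
Hypothesis h_homog : forall t, h t \is 1.-homog.
Hypothesis h'_homog : forall t, h' t \is 1.-homog.

Let idI : is_ideal I := homI.1.

Definition varprod (s : seq 'I_4) : CPoly 4 := \prod_(i <- s) 'X_i.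

Lemma varprod_homog s : varprod s \is (size s).-homog.
Proof.
rewrite /varprod; elim: s => [|i s IHs]; first by rewrite big_nil dhomog1.
by rewrite big_cons; exact: dhomogM (mpolyXU_homog _ i) IHs.
Qed.

(** Unfolds the recursion into one relation per word in the variables, that is, into a finite linear
    system. *)
Lemma in_mcolonP H H' k q G : in_mcolon I H H' a k q G <->
  forall u : k.-tuple 'I_4, in_colon I H H' a q (varprod u * G).
Proof.
elim: k G => [|k IHk] G; rewrite /varprod.
  split=> [E u|/(_ [tuple])]; last by rewrite big_nil mul1r.
  by rewrite tuple0 big_nil mul1r.
split=> [E u|E i] /=.
  case/tupleP: u => i u; rewrite big_cons mulrAC -mulrA [G * _]mulrC.
  by have /IHk /(_ u) := E i; congr (in_colon _ _ _ _ _ _); rewrite /varprod; ring.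
apply/IHk => u; have := E [tuple of i :: u]; rewrite /= big_cons.
by congr (in_colon _ _ _ _ _ _); rewrite /varprod; ring.
Qed.

Lemma in_colon_pihomog H H' q d G : H \is 1.-homog -> H' \is 1.-homog ->
  in_colon I H H' a q G -> in_colon I H H' a q (pihomog mdeg d G).
Proof.
move=> hH hH' [r Ir].
have hHq : H ^+ q \is q.-homog by have := dhomogMn q hH; rewrite mul1n.
have hHa : H' ^+ a \is (a).-homog by have := dhomogMn a hH'; rewrite mul1n.
have := homI.2 _ (d + a)%N Ir; rewrite hcompE linearB /=.
rewrite [_ * G]mulrC (pihomogM _ _ hHa) leq_addl addnK [_ * r]mulrC (pihomogM _ _ hHq).
case: ifP => _ Iq; last first.
  by exists 0; rewrite mulr0 mulrC.
by exists (pihomog mdeg (d + a - q) r); rewrite mulrC [_ ^+ q * _]mulrC.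
Qed.

(** The linear system sends unknowns [f] and [(g u)_u] to the tuple of [h' ^+ a * varprod u * f - h
    ^+ p.+1 * g u], read modulo [I]. [D0] bounds the sizes of the unknowns and [D1] those of the
    values; [K] indexes the coefficients of the former, [Y] those of the latter. *)
Let D0 := (a + m).+1.
Let D1 := (a + p + D0 + 4)%N.
Let U : finType := p.-tuple 'I_4.
Let Y : finType := (U * 'X_{1..4 < D1})%type.
Let K : finType := ('X_{1..4 < D0} + U * 'X_{1..4 < D0})%type.

Let Phi (H A : CPoly 4) (k : K) (u : U) : CPoly 4 :=
  match k with
  | inl mo => A * varprod u * 'X_[mo]
  | inr (u0, mo) => if u == u0 then - (H * 'X_[mo]) else 0
  end.

Let enc (G : U -> CPoly 4) : 'rV[CC]_#|Y| :=
  \row_(y < #|Y|) (G (enum_val y).1)@_(enum_val y).2.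

Let dec (w : 'rV[CC]_#|Y|) (u : U) : CPoly 4 :=
  \sum_(mo : 'X_{1..4 < D1}) w 0 (enum_rank (u, mo)) *: 'X_[mo].

Let Bm (H A : CPoly 4) : 'M[CC]_(#|K|, #|Y|) :=
  \matrix_(k < #|K|, y < #|Y|) (Phi H A (enum_val k) (enum_val y).1)@_(enum_val y).2.

Let fx (x : 'rV[CC]_#|K|) : CPoly 4 :=
  \sum_(mo : 'X_{1..4 < D0}) x 0 (enum_rank (inl mo : K)) *: 'X_[mo].

Let gx (x : 'rV[CC]_#|K|) (u : U) : CPoly 4 :=
  \sum_(mo : 'X_{1..4 < D0}) x 0 (enum_rank (inr (u, mo) : K)) *: 'X_[mo].

Let decD w1 w2 u : dec (w1 + w2) u = dec w1 u + dec w2 u.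
Proof.
by rewrite /dec -big_split; apply: eq_bigr => mo _; rewrite mxE scalerDl.
Qed.

Let decZ c w u : dec (c *: w) u = c *: dec w u.
Proof.
by rewrite /dec scaler_sumr; apply: eq_bigr => mo _; rewrite mxE scalerA.
Qed.

Let encK G u : (msize (G u) <= D1)%N -> dec (enc G) u = G u.
Proof.
move=> le_G; rewrite [RHS](mpolywE le_G) /dec; apply: eq_bigr => mo _.
by rewrite mxE enum_rankK.
Qed.

Let sum_msize b (c : 'X_{1..4 < b} -> CC) :
  (msize (\sum_(mo : 'X_{1..4 < b}) c mo *: 'X_[mo]) <= b)%N.
Proof.
apply: leq_trans (mmeasure_sum _ _ _ _) _; apply/bigmax_leqP => mo _.
by apply: leq_trans (msizeZ_le _ _) _; rewrite msizeX bmdeg.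
Qed.

Let mulBm x H A :
  x *m Bm H A = enc (fun u => A * varprod u * fx x - H * gx x u).
Proof.
apply/rowP => y; rewrite !mxE; set u := (enum_val y).1; set mo := (enum_val y).2.
rewrite (reindex (@enum_rank K)) /=; last first.
  by exists (@enum_val K K) => k _; [exact: enum_rankK | exact: enum_valK].
under eq_bigr => k _ do rewrite mxE enum_rankK -mcoeffZ -/u -/mo.
rewrite -[LHS]linear_sum /=; congr (_@_ _); rewrite big_sumType /=; congr (_ + _).
  by rewrite /fx mulr_sumr; apply: eq_bigr => mo' _; rewrite scalerAr.
transitivity (\sum_(u0 : U) \sum_(mo' : 'X_{1..4 < D0})
    x 0 (enum_rank (inr (u0, mo') : K)) *:
      (if u == u0 then - (H * 'X_[mo']) else 0)).
  by rewrite pair_bigA; apply: eq_bigr => -[].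
rewrite (bigD1 u) //= eqxx [X in _ + X]big1 ?addr0.
  rewrite /gx mulr_sumr -sumrN; apply: eq_bigr => mo' _.
  by rewrite scalerN scalerAr.
by move=> u0 /negPf u0u; rewrite big1 // => mo' _; rewrite eq_sym u0u scaler0.
Qed.

Let BmD H1 H2 A1 A2 : Bm (H1 + H2) (A1 + A2) = Bm H1 A1 + Bm H2 A2.
Proof.
apply/matrixP => k y; rewrite !mxE -mcoeffD; congr (_@_ _).
case: (enum_val k) => [mo|[u0 mo]] /=; first by ring.
by case: ifP => _; [ring | rewrite addr0].
Qed.

Let BmZ c H : Bm (c *: H) 0 = c *: Bm H 0.
Proof.
apply/matrixP => k y; rewrite !mxE -mcoeffZ; congr (_@_ _).
case: (enum_val k) => [mo|[u0 mo]] /=; first by rewrite !mul0r scaler0.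
by case: ifP => _; rewrite ?scaler0 // scalerN scalerAl.
Qed.

Let Bm0 : Bm 0 0 = 0.
Proof. by have := BmZ 0 0; rewrite !scale0r. Qed.

Let Bm_sum k (c : 'I_k -> CPoly 4) : Bm (\sum_i c i) 0 = \sum_i Bm (c i) 0.
Proof.
apply: (big_morph (Bm^~ 0)) => [H1 H2|]; last exact: Bm0.
by rewrite -BmD addr0.
Qed.

Let polyfun_Bm k y : polyfun pt (fun t => Bm (h t ^+ p.+1) (h' t ^+ a) k y).
Proof.
pose q t := Phi (h t ^+ p.+1) (h' t ^+ a) (enum_val k) (enum_val y).1.
have pq : polyfam pt q.
  rewrite /q /Phi; case: (enum_val k) => [mo|[u0 mo]].
    apply: polyfamM (polyfam_cst _ _); apply: polyfamM (polyfam_cst _ _).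
    exact: polyfamX.
  case: (_ == u0); last exact: polyfam_cst.
  by apply/polyfamN/polyfamM; [exact: polyfamX | exact: polyfam_cst].
by have [Q QE] := polyfam_coef (enum_val y).2 pq; exists Q => t; rewrite mxE -QE.
Qed.

(** Where the rank is maximal, a solution [(f, g)] deforms to first order as [h] moves along [L]:
    there are [f1] and [g1] with [h' ^+ a * u * f1 - h ^+ p.+1 * g1 u = - p.+1%:R *: (L * h ^+ p * g
    u)] modulo [I]. Multiplying by [h] and substituting the relation satisfied by [f] gives the
    claim. *)
Lemma generic_tangent : generic pt (fun t => forall f L,
  f \is m.-homog -> L \is 1.-homog ->
  (forall s : CC, exists t', h t' = h t + s *: L /\ h' t' = h' t) ->
  in_mcolon I (h t) (h' t) a p p.+1 f ->
  exists2 f', f' \is m.-homog &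
    in_mcolon I (h t) (h' t) a p p.+2 (h t * f' + p.+1%:R *: (L * f))).
Proof.
have [W WP] : exists W : 'M[CC]_#|Y|, forall w, (w <= W)%MS <-> forall u, I (dec w u).
  apply: subspace_mx => [u|w1 w2 I1 I2 u|c w Iw u].
  - by rewrite /dec big1 => [|mo _]; rewrite ?mxE ?scale0r //; exact: ideal0.
  - by rewrite decD; apply: idealD.
  - by rewrite decZ; apply: idealZ.
(* Stacking [W], whose row space consists of the tuples with entries in [I], turns solutions modulo
   [I] into genuine left kernel vectors. *)
pose B t := col_mx (Bm (h t ^+ p.+1) (h' t ^+ a)) W.
have pB i j : polyfun pt (fun t => B t i j).
  have [i' ->|i' ->] := split_ordP i.
    by have [Q QE] := polyfun_Bm i' j; exists Q => t; rewrite /B col_mxEu QE.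
  by exists (W i' j)%:MP => t; rewrite /B col_mxEd mevalC.
apply: generic_imp (generic_rank t0 pB) => t rk_max f L hf hL lineL Ef.
have hH k : h t ^+ k \is k.-homog by have := dhomogMn k (h_homog t); rewrite mul1n.
have hA : h' t ^+ a \is (a).-homog by have := dhomogMn a (h'_homog t); rewrite mul1n.
have hu (u : U) : varprod u \is p.-homog.
  by have := varprod_homog u; rewrite size_tuple.
have /fin_all_exists2 [g le_g gP] : forall u : U, exists2 g, (msize g <= D0)%N &
    I (h' t ^+ a * (varprod u * f) - h t ^+ p.+1 * g).
  move=> u; have /in_mcolonP /(_ u) [r Ir] := Ef.
  have := homI.2 _ (a + (p + m))%N Ir; rewrite hcompE linearB /=.
  have huf : h' t ^+ a * (varprod u * f) \is (a + (p + m)).-homog.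
    by apply: dhomogM => //; apply: dhomogM.
  rewrite (pihomog_dE huf) [h t ^+ _ * r]mulrC (pihomogM _ _ (hH _)).
  case: ifP => _ Ir'; last first.
    by exists 0; rewrite ?mulr0 // mmeasure0.
  exists (pihomog mdeg (a + (p + m) - p.+1) r); last by rewrite [h t ^+ _ * _]mulrC.
  by apply: leq_trans (homog_msize (pihomogP _ _ _)) _; rewrite /D0; lia.
pose x := \row_(k < #|K|) match enum_val k with
  | inl mo => f@_mo | inr (u, mo) => (g u)@_mo end.
have fxE : fx x = f.
  have le_f : (msize f <= D0)%N by apply: leq_trans (homog_msize hf) _; rewrite /D0; lia.
  by rewrite [RHS](mpolywE le_f); apply: eq_bigr => mo _; rewrite mxE enum_rankK.
have gxE u : gx x u = g u.
  by rewrite [RHS](mpolywE (le_g u)); apply: eq_bigr => mo _; rewrite mxE enum_rankK.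
have le_D1 H A x1 (u : U) : (msize H <= p.+2)%N -> (msize A <= a.+1)%N ->
    (msize (A * varprod u * fx x1 - H * gx x1 u) <= D1)%N.
  move=> le_H le_A; apply: leq_trans (mmeasureD_le _ _ _) _; rewrite geq_max mmeasureN.
  have le_u := homog_msize (hu u).
  have le_Au : (msize (A * varprod u) <= (a.+1 + p.+1).+1)%N.
    by apply: leq_trans (msizeM_le _ _) _; rewrite ltnS leq_add.
  apply/andP; split; apply: leq_trans (msizeM_le _ _) _.
    apply: (@leq_trans ((a.+1 + p.+1).+1 + D0).+1).
      by rewrite ltnS leq_add // sum_msize.
    by rewrite /D1; lia.
  apply: (@leq_trans (p.+2 + D0).+1); first by rewrite ltnS leq_add // sum_msize.
  by rewrite /D1; lia.
have le_A := homog_msize hA.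
have xW : (x *m Bm (h t ^+ p.+1) (h' t ^+ a) <= W)%MS.
  apply/WP => u; rewrite mulBm encK; last exact: le_D1 (homog_msize (hH _)) le_A.
  by rewrite fxE gxE -mulrA; exact: gP.
have [w0 w0E] := submxP xW.
have [c cP] := expr_line (h t) L p.
pose dH := p.+1%:R *: (L * h t ^+ p).
have hdH : (msize dH <= p.+2)%N.
  by apply: homog_msize; apply: dhomogZ; exact: dhomogM hL (hH p).
pose M2 : 'M[{poly CC}]_(#|K| + #|Y|, #|Y|) :=
  \sum_(i < p) 'X^i *: map_mx polyC (col_mx (Bm (c i) 0) 0).
have lineB s : exists t', B t + s *: col_mx (Bm dH 0) 0
    + s ^+ 2 *: map_mx (horner_eval s) M2 = B t'.
  have [t' [ht' h't']] := lineL s; exists t'.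
  have -> : map_mx (horner_eval s) M2 = col_mx (Bm (\sum_(i < p) s ^+ i *: c i) 0) 0.
    rewrite Bm_sum; apply/matrixP => k y.
    rewrite mxE /M2 summxE /horner_eval horner_sum.
    have [k' ->|k' ->] := split_ordP k; rewrite ?col_mxEu ?col_mxEd ?mxE.
      rewrite summxE; apply: eq_bigr => i _.
      by rewrite BmZ mxE [in LHS]mxE col_mxEu hornerM hornerXn hornerC [in RHS]mxE.
    rewrite big1 // => i _.
    by rewrite mxE [in X in (_ * X)]mxE col_mxEd mxE hornerM hornerC mulr0.
  rewrite /B ht' h't' cP !scale_col_mx !add_col_mx !scaler0 !addr0 -!BmZ.
  by rewrite -[in RHS](addr0 (h' t ^+ a)) BmD -[in RHS](addr0 (h' t ^+ a)) BmD.
have /submxP [x' x'E] : (row_mx x (- w0) *m col_mx (Bm dH 0) 0 <= B t)%MS.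
  apply: (mxrank_deformation (M2 := M2)) => [s|].
    by have [t' ->] := lineB s; exact: rk_max.
  by rewrite /B mul_row_col mulNmx w0E subrr.
rewrite -[x']hsubmxK in x'E; move: (lsubmx x') (rsubmx x') x'E => x1 w1.
rewrite !mul_row_col mulmx0 addr0 => x1E.
(* The solution [fx x1] may be inhomogeneous; its component of degree [m] inherits the relation
   because the other data are homogeneous. *)
exists (pihomog mdeg m (fx x1)); first exact: pihomogP.
apply/in_mcolonP => u.
have -> : varprod u * (h t * pihomog mdeg m (fx x1) + p.+1%:R *: (L * f)) =
    pihomog mdeg (p + m.+1) (varprod u * (h t * fx x1 + p.+1%:R *: (L * f))).
  rewrite [in RHS]mulrC (pihomogM _ _ (hu u)) leq_addr addKn linearD /=.
  rewrite [h t * fx x1]mulrC (pihomogM _ _ (h_homog t)) /= subn1 /= [RHS]mulrC.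
  congr (_ * (_ + _)); first exact: mulrC.
  by rewrite pihomog_dE //; apply: dhomogZ; exact: dhomogM hL hf.
apply: in_colon_pihomog => //; exists (gx x1 u).
have Iw : I (dec (w1 *m W) u) by have /WP := submxMl w1 W; exact.
have decE : - (dH * g u) =
    (h' t ^+ a * varprod u * fx x1 - h t ^+ p.+1 * gx x1 u) + dec (w1 *m W) u.
  have := congr1 (dec^~ u) x1E; rewrite decD !mulBm !encK.
  - by rewrite fxE gxE !mul0r add0r.
  - exact: le_D1 (homog_msize (hH _)) le_A.
  - by apply: le_D1 => //; rewrite mmeasure0.
have -> : h' t ^+ a * (varprod u * (h t * fx x1 + p.+1%:R *: (L * f))) -
    h t ^+ p.+2 * gx x1 u =
  - h t * dec (w1 *m W) u
    + (p.+1%:R *: L) * (h' t ^+ a * (varprod u * f) - h t ^+ p.+1 * g u).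
  have -> : dec (w1 *m W) u = - (dH * g u) -
     (h' t ^+ a * varprod u * fx x1 - h t ^+ p.+1 * gx x1 u).
    by rewrite decE addrC addKr.
  rewrite /dH -!mul_mpolyC; set e := p.+1%:R%:MP.
  by rewrite (exprS _ p.+1) (exprS _ p); ring.
by apply: idealD => //; apply: idealM.
Qed.

End Tangent.

(** * Linear substitutions *)

Definition linform n (r : 'rV[CC]_n) : CPoly n := \sum_i r 0 i *: 'X_i.

Lemma linformD n (r1 r2 : 'rV[CC]_n) : linform (r1 + r2) = linform r1 + linform r2.
Proof. by rewrite /linform -big_split; apply: eq_bigr => i _; rewrite mxE scalerDl. Qed.

Lemma linformZ n c (r : 'rV[CC]_n) : linform (c *: r) = c *: linform r.
Proof. by rewrite /linform scaler_sumr; apply: eq_bigr => i _; rewrite mxE scalerA. Qed.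

Lemma linform_delta n (i : 'I_n) : linform (delta_mx 0 i) = 'X_i.
Proof.
rewrite /linform (bigD1 i) //= mxE !eqxx scale1r big1 ?addr0 // => j /negPf ji.
by rewrite mxE eqxx ji scale0r.
Qed.

Lemma linform_homog n (r : 'rV[CC]_n) : linform r \is 1.-homog.
Proof.
by apply: rpred_sum => i _; apply: rpredZ; exact: mpolyXU_homog.
Qed.

Lemma linform_mPo n k (r : 'rV[CC]_n) (A : 'M[CC]_(n, k)) :
  linform r \mPo linsubst A = linform (r *m A).
Proof.
rewrite /linform rmorph_sum /=.
under eq_bigr => i _ do rewrite comp_mpolyZ comp_mpolyXU -tnth_nth tnth_mktuple scaler_sumr.
rewrite exchange_big; apply: eq_bigr => j _; rewrite mxE scaler_suml.
by apply: eq_bigr => i _; rewrite scalerA.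
Qed.

Lemma mpolyXU_mPo n k (i : 'I_n) (A : 'M[CC]_(n, k)) :
  'X_i \mPo linsubst A = linform (row i A).
Proof. by rewrite -linform_delta linform_mPo rowE. Qed.

Lemma comp_mpolyM n k (lq : n.-tuple (CPoly k)) (p q : CPoly n) :
  (p * q) \mPo lq = (p \mPo lq) * (q \mPo lq).
Proof. exact: rmorphM. Qed.

Lemma comp_mpolyXn n k (lq : n.-tuple (CPoly k)) (p : CPoly n) e :
  (p ^+ e) \mPo lq = (p \mPo lq) ^+ e.
Proof. exact: rmorphXn. Qed.

Lemma mPo_comp n k l (lp : n.-tuple (CPoly k)) (lq : k.-tuple (CPoly l)) lr p :
    (forall i, ('X_i \mPo lp) \mPo lq = 'X_i \mPo lr) ->
  (p \mPo lp) \mPo lq = p \mPo lr.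
Proof.
move=> eqX; elim/mpoly_ring_ind: p => [c|p q IHp IHq|p q IHp IHq|i].
- by rewrite !comp_mpolyC.
- rewrite (comp_mpolyD lp p q) (comp_mpolyD lq (p \mPo lp) (q \mPo lp)).
  rewrite (comp_mpolyD lr p q); exact: (congr2 +%R IHp IHq).
- rewrite (comp_mpolyM lp p q) (comp_mpolyM lq (p \mPo lp) (q \mPo lp)).
  rewrite (comp_mpolyM lr p q); exact: (congr2 *%R IHp IHq).
- exact: eqX.
Qed.

Lemma linsubstM n k l (A : 'M[CC]_(n, k)) (B : 'M[CC]_(k, l)) p :
  (p \mPo linsubst A) \mPo linsubst B = p \mPo linsubst (A *m B).
Proof.
by apply: mPo_comp => i; rewrite !mpolyXU_mPo linform_mPo row_mul.
Qed.

Lemma linsubst1 n (p : CPoly n) : p \mPo linsubst 1%:M = p.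
Proof.
elim/mpoly_ring_ind: p => [c|p q IHp IHq|p q IHp IHq|i].
- by rewrite comp_mpolyC.
- by rewrite comp_mpolyD IHp IHq.
- by rewrite rmorphM /= IHp IHq.
- by rewrite mpolyXU_mPo row1 linform_delta.
Qed.

Lemma mPo_cong n (J : CPoly n -> Prop) (lq : n.-tuple (CPoly n)) p :
  is_ideal J -> (forall i, J ('X_i - ('X_i \mPo lq))) -> J (p - (p \mPo lq)).
Proof.
move=> iJ JX; elim/mpoly_ring_ind: p => [c|p q IHp IHq|p q IHp IHq|i].
- by rewrite comp_mpolyC subrr; exact: ideal0.
- rewrite (comp_mpolyD lq p q) opprD addrACA; exact: idealD iJ IHp IHq.
- rewrite (comp_mpolyM lq p q).
  move: (comp_mpoly lq p) (comp_mpoly lq q) IHp IHq => p' q' IHp IHq.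
  have -> : p * q - p' * q' = q * (p - p') + p' * (q - q') by ring.
  exact: idealD iJ (idealM q iJ IHp) (idealM p' iJ IHq).
- exact: JX.
Qed.

Lemma homog_linsubst n k (A : 'M[CC]_(n, k)) d p :
  p \is d.-homog -> p \mPo linsubst A \is d.-homog.
Proof.
move/dhomogP => hp; rewrite comp_mpolyE; rewrite big_seq.
apply: rpred_sum => m /hp /= <-; apply: rpredZ.
rewrite mdegE; elim/big_rec2: _ => [|i e q _ hq]; first exact: dhomog1.
apply: dhomogM => //; rewrite tnth_mktuple.
have := dhomogMn (m i) (linform_homog (row i A)); rewrite mul1n /linform.
by under eq_bigr => j _ do rewrite mxE.
Qed.

Lemma pihomog_sum n (F : nzRingType) K d (f : nat -> {mpoly F[n]}) :
    (forall i, f i \is i.-homog) -> (d < K)%N ->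
  pihomog mdeg d (\sum_(i < K) f i) = f d.
Proof.
move=> hf lt_d; rewrite linear_sum (bigD1 (Ordinal lt_d) isT) /=.
rewrite (pihomog_dE (hf d)) big1 ?addr0 // => i ne_i.
apply: (pihomog_ne0 _ (hf i)); apply: contraNneq ne_i => id.
by apply/eqP/val_inj.
Qed.

Lemma pihomog_linsubst n k (A : 'M[CC]_(n, k)) d p :
  pihomog mdeg d (p \mPo linsubst A) = pihomog mdeg d p \mPo linsubst A.
Proof.
set K := maxn (msize p) d.+1.
have lt_d : (d < K)%N by rewrite leq_max ltnSn orbT.
have le_p : (msize p <= K)%N by rewrite leq_maxl.
rewrite -(@pihomog_sum _ _ K d (fun i => pihomog mdeg i p \mPo linsubst A)) //.
  by rewrite -linear_sum -(pihomog_partitionE le_p).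
by move=> i; apply: homog_linsubst; exact: pihomogP.
Qed.

Lemma shom_linsubst n k (A : 'M[CC]_(n, k)) e d p :
  shom e d p -> shom e d (p \mPo linsubst A).
Proof.
rewrite /shom; case: ifP => _; first exact: homog_linsubst.
by move/eqP ->; rewrite comp_mpoly0.
Qed.

(** * Absence of minimal syzygies *)

Section MinimalSyzygies.
Variables (n : nat) (J : CPoly n.+3 -> Prop) (g : seq (CPoly n.+3)) (e0 : nat).
Hypothesis gJ : min_hgens J g.
Hypothesis no_min : forall d, (d <= e0)%N -> ~ min_syz_in_deg g d.

Let gk (k : 'I_(size g)) := g`_k.
Let dg (k : 'I_(size g)) := pdeg g`_k.

Lemma min_hgens_homog k : gk k \is (dg k).-homog.
Proof. by have [/(_ k (ltn_ord k)) [_]] := gJ. Qed.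

Lemma min_hgens_in_gen z : J z <-> in_gen gk z.
Proof.
have [_ /(_ z) JE _] := gJ; rewrite JE; split=> [[c [_ ->]]|[c ->]].
  by exists (fun k => c`_k).
exists [seq c k | k <- enum 'I_(size g)]; split; first by rewrite size_map size_enum_ord.
by apply: eq_bigr => k _; rewrite (nth_map k) ?size_enum_ord // nth_ord_enum.
Qed.

(** Graded Nakayama: a nonzero syzygy of least degree is not a combination of syzygies of lower
    degree, hence is minimal. *)
Lemma syz_of_deg0 d s : (d <= e0)%N -> syz_of_deg g d s ->
  forall k, (k < size g)%N -> s`_k = 0.
Proof.
elim: d s => [|d IHd] s le_d ss.
all: have [[sz_s _ _] ] := (ss, no_min le_d).
all: move=> nomin; have [->|s_neq0] := eqVneq s (nseq (size g) 0);
  first by move=> k ltk; rewrite nth_nseq ltk.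
  by case: nomin; exists s; split=> //; split; [exact/eqP | case=> t []].
apply: NNPP => s0; apply: nomin; exists s; split=> //; split; first exact/eqP.
case=> t [_ [tP sE]]; apply: s0 => k ltk; rewrite sE // big1 // => v _.
by rewrite (IHd (t v)) ?mulr0 // ltnW.
Qed.

Lemma no_syzygies e (c : 'I_(size g) -> CPoly n.+3) : (e <= e0)%N ->
    (forall k, shom e (dg k) (c k)) -> \sum_k c k * gk k = 0 ->
  forall k, c k = 0.
Proof.
move=> le_e hc c0 k; pose s := [seq c k | k <- enum 'I_(size g)].
have sE (l : 'I_(size g)) : s`_l = c l.
  by rewrite (nth_map l) ?size_enum_ord // nth_ord_enum.
rewrite -sE; apply: (@syz_of_deg0 e s) => //; split.
- by rewrite size_map size_enum_ord.
- by move=> l ltl; rewrite (sE (Ordinal ltl)); exact: hc (Ordinal ltl).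
- by rewrite -[RHS]c0; apply: eq_bigr => l _; rewrite sE.
Qed.

End MinimalSyzygies.

(** * Restriction to a plane *)

Lemma principal_ideal n (h : CPoly n) : is_ideal (fun q => exists s, q = h * s).
Proof.
split=> [|_ _ [s ->] [t ->]|_ q [s ->]].
- by exists 0; rewrite mulr0.
- by exists (s + t); rewrite mulrDr.
- by exists (q * s); rewrite mulrCA.
Qed.

Section Restriction.
Variables (I : CPoly 4 -> Prop) (phi : 'M[CC]_(4, 3)) (B : 'M[CC]_(3, 4)).
Variables (h : CPoly 4) (h' : 'rV[CC]_4) (a m : nat).
Hypothesis phiK : B *m phi = 1%:M.
Hypothesis h_phi : h \mPo linsubst phi = 0.
Hypothesis X_phiB : forall i : 'I_4, exists d,
  'X_i = linform (row i (phi *m B)) + d *: h.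

Let l (j : 'I_3) := linform (row j B).
Let J := colon_pow (restr_ideal phi I) (induced_form phi h') a.

Lemma restr_l j : l j \mPo linsubst phi = 'X_j.
Proof. by rewrite linform_mPo -row_mul phiK row1 linform_delta. Qed.

Lemma restr_lift q : (q \mPo linsubst B) \mPo linsubst phi = q.
Proof. by rewrite linsubstM phiK linsubst1. Qed.

(** Substituting [phi *m B] changes each variable by a multiple of [h], so modulo [h] a polynomial
    is determined by its restriction. *)
Lemma restr_ker q : q \mPo linsubst phi = 0 -> exists s, q = h * s.
Proof.
move=> q0; have [i|s] := mPo_cong (lq := linsubst (phi *m B)) q (principal_ideal h).
  have [d Xi] := X_phiB i; exists d%:MP; rewrite mpolyXU_mPo {1}Xi addrC addKr.
  by rewrite mulrC mul_mpolyC.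
by rewrite -linsubstM q0 comp_mpoly0 subr0 => ->; exists s.
Qed.

(** Through this dictionary the consequences of having no syzygies on the plane are carried over to
    four variables. *)
Lemma in_colon_restr z :
  in_colon I h (linform h') a 1 z <-> J (z \mPo linsubst phi).
Proof.
have zE : (z \mPo linsubst phi) * induced_form phi h' ^+ a =
    (linform h' ^+ a * z) \mPo linsubst phi.
  rewrite (comp_mpolyM (linsubst phi) (linform h' ^+ a) z).
  by rewrite (comp_mpolyXn (linsubst phi) (linform h') a) mulrC.
rewrite /J /colon_pow /restr_ideal zE; split=> [[r Ir]|[q [Iq qE]]].
  exists (linform h' ^+ a * z - h ^+ 1 * r); split; first exact: Ir.
  rewrite (comp_mpolyB (linsubst phi) (linform h' ^+ a * z) (h ^+ 1 * r)) expr1.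
  by rewrite (comp_mpolyM (linsubst phi) h r) h_phi mul0r subr0.
have [|s sE] := @restr_ker (linform h' ^+ a * z - q).
  by rewrite (comp_mpolyB (linsubst phi) (linform h' ^+ a * z) q) qE subrr.
by exists s; rewrite expr1 -sE subKr.
Qed.

Variable g : seq (CPoly 3).
Hypothesis gJ : min_hgens J g.
Hypothesis no_min : forall d, (d <= m.+2)%N -> ~ min_syz_in_deg g d.

Lemma restr_socle d z : (d <= m)%N -> z \is d.-homog ->
  (forall j, in_colon I h (linform h') a 1 (l j * z)) ->
  in_colon I h (linform h') a 1 z.
Proof.
move=> le_d hz lz; apply/in_colon_restr/(min_hgens_in_gen gJ).
apply: (nosyz_socle (min_hgens_homog gJ) (no_syzygies no_min) (d := d)) => //.
  exact: homog_linsubst.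
move=> j; apply/(min_hgens_in_gen gJ).
have /in_colon_restr := lz j; congr (J _).
by rewrite (comp_mpolyM (linsubst phi) (l j) z) restr_l.
Qed.

Lemma restr_koszul d (w : 'I_3 -> CPoly 4) : (d <= m)%N ->
  (forall j, w j \is d.-homog) ->
  (forall i j, in_colon I h (linform h') a 1 (l i * w j - l j * w i)) ->
  exists2 w0, shom d 1 w0 &
    forall j, in_colon I h (linform h') a 1 (w j - l j * w0).
Proof.
move=> le_d hw lw.
have [||i j|w0 hw0 w0E] := nosyz_koszul (min_hgens_homog gJ) (no_syzygies no_min)
    (d := d) (z := fun j => w j \mPo linsubst phi).
- by [].
- by move=> j; exact: homog_linsubst.
- apply/(min_hgens_in_gen gJ); have /in_colon_restr := lw i j; congr (J _).
  rewrite (comp_mpolyB (linsubst phi) (l i * w j) (l j * w i)).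
  rewrite (comp_mpolyM (linsubst phi) (l i) (w j)).
  by rewrite (comp_mpolyM (linsubst phi) (l j) (w i)) !restr_l.
exists (w0 \mPo linsubst B) => [|j]; first exact: shom_linsubst.
apply/in_colon_restr; have /(min_hgens_in_gen gJ) := w0E j; congr (J _).
rewrite (comp_mpolyB (linsubst phi) (w j) (l j * (w0 \mPo linsubst B))).
rewrite (comp_mpolyM (linsubst phi) (l j) (w0 \mPo linsubst B)).
by rewrite restr_l restr_lift.
Qed.

End Restriction.

(** * The element of the quotient ideal given by the generic initial ideal *)

(** The indices of [x_3] and [x_4], written through the splitting [4 = 3 + 1] of the block matrices
    below. *)
Definition v3 : 'I_4 := lshift 1 (ord_max : 'I_3).
Definition v4 : 'I_4 := rshift 3 (ord0 : 'I_1).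

Lemma ord4_v4 (i : 'I_4) : (v4 < i)%N = false.
Proof. by case: i => -[|[|[|[|]]]]. Qed.

Lemma mon3_v3 i j k : mon3 i j k v3 = k. Proof. by rewrite mnmE. Qed.
Lemma mon3_v4 i j k : mon3 i j k v4 = 0%N. Proof. by rewrite mnmE. Qed.

Lemma mdeg_mon3 i j k : mdeg (mon3 i j k) = (i + j + k)%N.
Proof.
by rewrite mdegE !big_ord_recl big_ord0 !mnmE /= !addn0 !addnA.
Qed.

Lemma mcoeffMXU n (F : nzRingType) (r : {mpoly F[n]}) (i : 'I_n) (mm : 'X_{1..n}) :
  mm i = 0%N -> (r * 'X_i)@_mm = 0.
Proof.
move=> mi0; apply/eqP; rewrite mcoeff_eq0 (perm_mem (msuppMX _ _)).
by apply/mapP => -[m' _ mE]; move: mi0; rewrite mE mnmDE mnm1E eqxx.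
Qed.

Lemma mcoeff_pihomog n (F : nzRingType) d (q : {mpoly F[n]}) mm :
  mdeg mm = d -> (pihomog mdeg d q)@_mm = q@_mm.
Proof.
move=> dmm; set K := maxn (msize q) d.+1.
have lt_d : (d < K)%N by rewrite leq_max ltnSn orbT.
have le_q : (msize q <= K)%N by rewrite leq_maxl.
rewrite [q in RHS](pihomog_partitionE le_q) (bigD1 (Ordinal lt_d) isT) /=.
rewrite mcoeffD [X in _ + X](raddf_sum (mcoeff mm)).
rewrite big1 ?addr0 // => l ne_l.
apply: (dhomog_nemf_coeff (pihomogP mdeg l q)); rewrite /= dmm.
by apply: contraNneq ne_l => dl; apply/eqP/val_inj.
Qed.

Lemma revlex_v3 i j k (mm : 'X_{1..4}) : mm v4 = 0%N -> revlex_gt (mon3 i j k) mm -> (k <= mm v3)%N.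
Proof.
move=> mm4 [i0 [lt_i0 eq_i0]]; have := eq_i0 v3; have := eq_i0 v4.
rewrite mon3_v3; case: i0 lt_i0 eq_i0 => -[|[|[|[|//]]]] lt0.
- by move=> _ _ _ /(_ isT) ->.
- by move=> _ _ _ /(_ isT) ->.
- have -> : Ordinal lt0 = v3 by apply: val_inj.
  by rewrite mon3_v3 => /ltnW.
- have -> : Ordinal lt0 = v4 by apply: val_inj.
  by rewrite mm4 ltn0.
Qed.

(** Characteristic property of the reverse lexicographic order: the leading monomial is free of
    ['X_v4], so every monomial of [q] free of ['X_v4] is divisible by ['X_v3 ^+ k], and [q] is
    divisible by ['X_v3 ^+ a] modulo ['X_v4]. *)
Lemma lead_mon_split (q : CPoly 4) i j k a : (a <= k)%N ->
    q \is (i + j + k).-homog -> is_lead_mon q (mon3 i j k) ->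
  exists2 f, f \is (i + j + (k - a)).-homog &
    exists r, q = f * 'X_v3 ^+ a + r * 'X_v4.
Proof.
move=> le_ak hq [_ lead_q].
have ge_k (mm : 'X_{1..4}) : mm \in msupp q -> mm v4 = 0%N -> (k <= mm v3)%N.
  move=> mm_q mm4; have [->|/eqP ne_mm] := eqVneq mm (mon3 i j k).
    by rewrite mon3_v3.
  have [|[_ ]] := lead_q mm mm_q ne_mm; last exact: revlex_v3.
  by rewrite mdeg_mon3 (dhomog_mf hq mm_q) /= ltnn.
suff [f [r qE]] : exists f r, q = f * 'X_v3 ^+ a + r * 'X_v4.
  exists (pihomog mdeg (i + j + (k - a)) f); first exact: pihomogP.
  have hX3 : 'X_v3 ^+ a \is [in CC[4], a.-homog].
    by have := dhomogMn a (mpolyXU_homog CC v3); rewrite mul1n.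
  rewrite -(pihomog_dE hq) qE linearD /= (pihomogM _ _ hX3).
  rewrite (pihomogM _ _ (mpolyXU_homog CC v4)) -addnBA // (leq_trans le_ak) ?leq_addl //.
  by case: ifP => _; eexists; [|rewrite -[X in _ + X](mul0r 'X_v4)].
exists (\sum_(mm <- msupp q | mm v4 == 0%N) q@_mm *: 'X_[mm - U_(v3) *+ a]).
exists (\sum_(mm <- msupp q | mm v4 != 0%N) q@_mm *: 'X_[mm - U_(v4)]).
rewrite {1}[q]mpolyE (bigID (fun mm : 'X_{1..4} => mm v4 == 0%N)) /=.
rewrite !mulr_suml; congr (_ + _).
  rewrite big_seq_cond [RHS]big_seq_cond; apply: eq_bigr => mm /andP [mm_q /eqP mm4].
  rewrite -scalerAl mpolyXn -mpolyXD submK //; apply/mnm_lepP => i0.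
  rewrite mulmnE mnm1E; case: eqP => [<-|]; last by rewrite mul0n.
  by rewrite mul1n (leq_trans le_ak) // ge_k.
apply: eq_bigr => mm mm4; rewrite -scalerAl -mpolyXD submK //.
by apply/mnm_lepP => i0; rewrite mnm1E; case: eqP => [<-|//]; rewrite lt0n.
Qed.

Lemma exprD_mod (R : comNzRingType) (x y : R) a :
  exists S, (x + y) ^+ a = x ^+ a + y * S.
Proof.
elim: a => [|a [S IH]]; first by exists 0; rewrite !expr0 mulr0 addr0.
exists (x ^+ a + (x + y) * S); rewrite !exprS IH; ring.
Qed.

Section GinElement.
Variables (I : CPoly 4 -> Prop) (M : 'X_{1..4} -> Prop) (g : 'M[CC]_4).
Variables (i j k a : nat) (H H' : CPoly 4) (D e psi : CC).
Hypothesis homI : is_homog_ideal I.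
Hypothesis g_unit : g \in unitmx.
Hypothesis ME : forall mm, M mm <-> in_mon (transf_ideal g I) mm.
Hypothesis minM : min_gen M (mon3 i j k).
Hypothesis a_gt0 : (0 < a)%N.
Hypothesis le_ak : (a <= k)%N.
Hypothesis D_neq0 : D != 0.
Hypothesis HE : H \mPo linsubst g = D *: 'X_v4.
Hypothesis H'E : H' \mPo linsubst g = psi *: 'X_v3 + e *: 'X_v4.

Let G p := p \mPo linsubst g.
Let G' p := p \mPo linsubst (invmx g).

Let GK p : G' (G p) = p.
Proof. by rewrite /G /G' linsubstM (mulmxV g_unit) linsubst1. Qed.

Let G'K p : G (G' p) = p.
Proof. by rewrite /G /G' linsubstM (mulVmx g_unit) linsubst1. Qed.

Let GM p q : G (p * q) = G p * G q. Proof. exact: comp_mpolyM. Qed.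
Let GB p q : G (p - q) = G p - G q. Proof. exact: comp_mpolyB. Qed.
Let GX p n : G (p ^+ n) = G p ^+ n. Proof. exact: comp_mpolyXn. Qed.
Let GZ c p : G (c *: p) = c *: G p. Proof. exact: comp_mpolyZ. Qed.
Let GHE : G H = D *: 'X_v4. Proof. exact: HE. Qed.
Let GH'E : G H' = psi *: 'X_v3 + e *: 'X_v4. Proof. exact: H'E. Qed.
Let Gpi d p : pihomog mdeg d (G p) = G (pihomog mdeg d p).
Proof. exact: pihomog_linsubst. Qed.
Let G'_homog d p : p \is d.-homog -> G' p \is d.-homog.
Proof. exact: homog_linsubst. Qed.
Let transfG p : I p -> transf_ideal g I (G p).
Proof. by move=> Ip; exact: (ex_intro _ p (conj Ip erefl)). Qed.
Let transfE q : transf_ideal g I q -> exists2 p, I p & q = G p.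
Proof. by move=> [p [Ip qE]]; exact: (ex_intro2 _ _ p Ip qE). Qed.

(** In the coordinates [g], a form with leading monomial [mon3 i j k] is [f1 * 'X_v3 ^+ a] modulo
    ['X_v4], which puts [f1] in the quotient ideal. If [f1] came from [I + (H)], then
    [mon3 i j (k - a)] would be a leading monomial, against minimality. *)
Lemma gin_element : exists2 f, f \is (i + j + (k - a)).-homog &
  in_colon I H H' a 1 f /\ forall r, ~ I (f - H * r).
Proof.
have iI : is_ideal I := homI.1.
move: G G' GK G'K GM GB GX GZ GHE GH'E Gpi G'_homog transfG transfE.
move=> Gf G'f GfK G'fK GfM GfB GfX GfZ GfH GfH' Gfpi G'fhom transfGf transfEf.
have [/ME [q [/transfEf [p Ip qE] [q_lead lead_q]]] min_q] := minM.
set m := (i + j + (k - a))%N; set d := (i + j + k)%N.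
pose qd := pihomog mdeg d q; pose pd := pihomog mdeg d p.
have Ipd : I pd by have := homI.2 p d Ip; rewrite hcompE.
have qdE : qd = Gf pd by rewrite /qd qE Gfpi.
have qd_coef mm : mdeg mm = d -> qd@_mm = q@_mm by exact: mcoeff_pihomog.
have hqd : qd \is d.-homog by exact: pihomogP.
have lead_qd : is_lead_mon qd (mon3 i j k).
  split; first by move: q_lead; rewrite !mcoeff_msupp qd_coef ?mdeg_mon3.
  move=> mm mm_qd; apply: lead_q; move: (mm_qd).
  by rewrite !mcoeff_msupp qd_coef // (dhomog_mf hqd mm_qd).
have [f1 hf1 [r1 qdE']] := lead_mon_split le_ak hqd lead_qd.
have f1_coef (mm : 'X_{1..4}) : mm v4 = 0%N -> f1@_mm = qd@_(U_(v3) *+ a + mm).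
  move=> mm4; rewrite qdE' mcoeffD mpolyXn mcoeffMX mcoeffMXU ?addr0 //.
  by rewrite mnmDE mulmnE mnm1E mm4.
exists (G'f f1); [exact: G'fhom | split=> [|r Ir]].
  have [S SE] := exprD_mod (psi *: 'X_v3) (e *: 'X_v4 : CPoly 4) a.
  (* One term comes from expanding [H' ^+ a] modulo ['X_v4], the other from replacing
     [f1 * 'X_v3 ^+ a] by [qd - r1 * 'X_v4]; [D^-1] is there because [H] becomes [D *: 'X_v4]. *)
  exists (G'f (D^-1 *: (e *: S * f1 - psi ^+ a *: r1))).
  have -> : H' ^+ a * G'f f1 - H ^+ 1 * G'f (D^-1 *: (e *: S * f1 - psi ^+ a *: r1)) =
     psi ^+ a *: pd.
    rewrite -[LHS]GfK -[RHS]GfK; congr (G'f _).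
    rewrite GfB GfZ -qdE qdE' !GfM GfX !G'fK GfH' SE expr1 GfH exprZn.
    set Z := _ - psi ^+ a *: r1.
    have -> : D *: 'X_v4 * (D^-1 *: Z) = 'X_v4 * Z.
      by rewrite -scalerAl -scalerAr scalerA mulfV // scale1r.
    rewrite /Z -!mul_mpolyC; ring.
  exact: idealZ.
have [s sE] : exists s, Gf (pihomog mdeg m (G'f f1 - H * r)) = f1 - s * 'X_v4.
  rewrite -Gfpi GfB G'fK GfM GfH linearB /= (pihomog_dE hf1).
  rewrite -scalerAl linearZ /= mulrC (pihomogM _ _ (mpolyXU_homog CC v4)).
  case: ifP => _; [exists (D *: pihomog mdeg (m - 1) (Gf r)) | exists 0].
    by rewrite scalerAl.
  by rewrite scaler0 mul0r.
have s_coef (mm : 'X_{1..4}) : mm v4 = 0%N -> (f1 - s * 'X_v4)@_mm = qd@_(U_(v3) *+ a + mm).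
  by move=> mm4; rewrite mcoeffB mcoeffMXU // subr0 f1_coef.
have mon3E : (U_(v3) *+ a + mon3 i j (k - a))%MM = mon3 i j k.
  apply/mnmP => l; rewrite mnmDE mulmnE mnm1E !mnmE.
  by case: l => -[|[|[|[|//]]]] lt_l //=; rewrite mul1n subnKC.
have M0 : M (mon3 i j (k - a)).
  apply/ME; exists (f1 - s * 'X_v4); split.
    rewrite -sE; apply: transfGf; have := homI.2 _ m Ir; by rewrite hcompE.
  have hmm mm : mm \in msupp (f1 - s * 'X_v4) -> mdeg mm = m.
    rewrite -sE -Gfpi => mm_in; exact: (dhomog_mf (pihomogP mdeg m _) mm_in).
  split.
    rewrite mcoeff_msupp s_coef ?mon3_v4 // mon3E -mcoeff_msupp.
    by case: lead_qd.
  move=> mm mm_in ne_mm; right; split; first by rewrite (hmm _ mm_in) mdeg_mon3.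
  (* A monomial containing ['X_v4] is smaller than one that does not; the others are compared inside
     [qd] after multiplication by ['X_v3 ^+ a]. *)
  have [mm4|mm4] := posnP (mm v4); last first.
    by exists v4; rewrite mon3_v4; split=> // l; rewrite ord4_v4.
  have mm'_in : (U_(v3) *+ a + mm)%MM \in msupp qd.
    by rewrite mcoeff_msupp -s_coef // -mcoeff_msupp.
  have [] := lead_qd.2 _ mm'_in; first by rewrite -mon3E => /addmI.
    by rewrite mdeg_mon3 (dhomog_mf hqd mm'_in) /= ltnn.
  case=> _ [l [lt_l eq_l]]; exists l; rewrite -mon3E in lt_l eq_l.
  split; first by move: lt_l; rewrite !mnmDE ltn_add2l.
  by move=> l' /eq_l; rewrite !mnmDE => /addnI.
have div0 : mdiv (mon3 i j (k - a)) (mon3 i j k).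
  by move=> l; rewrite -mon3E mnmDE leq_addl.
have := min_q _ M0 div0.
move/(congr1 (fun mm : 'X_{1..4} => mm v3)); rewrite !mon3_v3 => kE.
by move: a_gt0 le_ak kE; lia.
Qed.

End GinElement.

(** * Frames *)

(** A column [c], fixed once and for all, completes a parametrised plane to coordinates of the whole
    space that depend polynomially on [phi]. *)
Definition frame (c : 'cV[CC]_4) (phi : 'M[CC]_(4, 3)) : 'M[CC]_4 :=
  row_mx phi c.

(* The linear form cutting out the image of [phi]; it is polynomial in [phi]. *)
Definition plane_row (c : 'cV[CC]_4) (phi : 'M[CC]_(4, 3)) : 'rV[CC]_4 :=
  row v4 (\adj (frame c phi)).

Lemma frameEl c phi x (y : 'I_3) : frame c phi x (lshift 1 y : 'I_4) = phi x y.
Proof. exact: row_mxEl. Qed.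

Lemma frameEr c phi x (y : 'I_1) : frame c phi x (rshift 3 y : 'I_4) = c x y.
Proof. exact: row_mxEr. Qed.

Section Frame.
Variables (c : 'cV[CC]_4) (phi : 'M[CC]_(4, 3)).
Hypothesis det_frame : \det (frame c phi) != 0.
Let D := \det (frame c phi).
Let g := frame c phi.

Definition coframe : 'M[CC]_(3 + 1, 4) := invmx g.

Let g_unit : g \in unitmx. Proof. by rewrite unitmxE unitfE. Qed.

Lemma adj_frame : \adj g = D *: invmx g.
Proof. by rewrite /invmx g_unit scalerA mulfV // scale1r. Qed.

Lemma coframeK : [/\ usubmx coframe *m phi = 1%:M, dsubmx coframe *m phi = 0
  & phi *m usubmx coframe + c *m dsubmx coframe = 1%:M].
Proof.
have E : col_mx (usubmx coframe) (dsubmx coframe) *m row_mx phi c = 1%:M.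
  by rewrite vsubmxK; exact: (mulVmx g_unit).
move: E; rewrite mul_col_row [in X in X -> _](scalar_mx_block 3 1).
move=> /eq_block_mx [uphi _ dphi _].
split; [exact: uphi | exact: dphi | rewrite -mul_row_col vsubmxK].
exact: (mulmxV g_unit).
Qed.

Lemma plane_rowE : plane_row c phi = D *: dsubmx coframe.
Proof.
rewrite /plane_row -/g adj_frame; apply/rowP => i.
by rewrite !mxE; congr (_ * _); congr (invmx g _ _); apply: val_inj.
Qed.

Lemma plane_row_phi : linform (plane_row c phi) \mPo linsubst phi = 0.
Proof.
have [_ dphi _] := coframeK.
rewrite linform_mPo plane_rowE -scalemxAl dphi scaler0 /linform big1 // => i _.
by rewrite mxE scale0r.
Qed.

Lemma X_coframe (i : 'I_4) : exists d,
  'X_i = linform (row i (phi *m usubmx coframe)) + d *: linform (plane_row c phi).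
Proof.
have [_ _ gE] := coframeK; exists (c i 0 * D^-1).
rewrite plane_rowE linformZ scalerA -mulrA mulVf // mulr1 -linformZ -linformD.
rewrite -linform_delta; congr linform.
have -> : c i 0 *: dsubmx coframe = row i (c *m dsubmx coframe).
  by apply/rowP => l; rewrite !mxE big_ord1 !mxE.
by rewrite -linearD /= gE row1.
Qed.

(* The frame is multiplied on the right by an elementary matrix, hence its
   adjugate on the left by the inverse one. *)
Lemma plane_row_line (j : 'I_3) s :
  plane_row c (phi - s *: (c *m delta_mx 0 j)) =
  plane_row c phi + (s * D) *: row j (usubmx coframe).
Proof.
pose j' : 'I_4 := lshift 1 j.
pose d : 'M[CC]_4 := delta_mx v4 j'.
have jv4 : j' != v4.
  by apply/eqP => /(congr1 val) /= jE; have := ltn_ord j; rewrite jE.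
have dd : d *m d = 0 by rewrite /d mul_delta_mx_0.
have gE : frame c (phi - s *: (c *m delta_mx 0 j)) = g *m (1%:M - s *: d).
  rewrite mulmxBr mulmx1 -scalemxAr; apply/matrixP => x y.
  have gd : (g *m d) x y = (y == j')%:R * c x 0.
    rewrite mxE (bigD1 v4) //= big1 => [|l lv4]; last first.
      by rewrite [d _ _]mxE (negPf lv4) mulr0.
    by rewrite addr0 [d _ _]mxE eqxx mulrC /g frameEr.
  have -> : (g - s *: (g *m d)) x y = g x y - s * (g *m d) x y.
    by rewrite [LHS]mxE; congr (_ + _); rewrite [LHS]mxE; congr (- _); rewrite mxE.
  rewrite gd.
  have [y' ->|y' ->] := split_ordP (y : 'I_(3 + 1)).
    rewrite /g !frameEl !mxE big_ord1 !mxE eqxx /j' (inj_eq (@lshift_inj 3 1)) /=.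
    by rewrite [c _ _ * _]mulrC.
  have -> : ((rshift 3 y' : 'I_4) == j') = false.
    by apply/eqP => /(congr1 val) /= jE; have := ltn_ord j; rewrite -jE.
  by rewrite /g !frameEr mul0r mulr0 subr0.
have detE : \det (1%:M - s *: d) = 1.
  rewrite det_trig; last first.
    apply/is_trig_mxP => x y lt_xy; rewrite !mxE.
    have -> : (x == y) = false by apply/negbTE; rewrite -val_eqE neq_ltn lt_xy.
    case: eqP => [xv|_]; last by rewrite mulr0 subr0.
    by move: lt_xy; rewrite xv ord4_v4.
  rewrite big1 // => x _; rewrite !mxE eqxx.
  by case: eqP => [->|_]; rewrite ?mulr0 ?subr0 //= eq_sym (negPf jv4) mulr0 subr0.
set g' := frame c _ in gE *.
have g'_unit : g' \in unitmx by rewrite unitmxE gE det_mulmx detE mulr1 -unitmxE.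
have adjE : \adj g' = (1%:M + s *: d) *m \adj g.
  apply: (can_inj (mulmxK g'_unit)).
  rewrite mul_adj_mx gE det_mulmx detE mulr1 !mulmxA -[_ *m \adj g *m g]mulmxA.
  rewrite mul_adj_mx mul_mx_scalar -scalemxAl mulmxDl mulmxBr !mulmx1 mul1mx.
  rewrite mulmxBr mulmx1 -scalemxAl -scalemxAr dd !scaler0 subr0 subrK.
  by rewrite scalemx1.
rewrite /plane_row -/g' -/g adjE mulmxDl mul1mx linearD /=; congr (_ + _).
rewrite -scalemxAl linearZ /= -scalerA; congr (_ *: _).
rewrite rowE mulmxA mul_delta_mx -rowE adj_frame linearZ /=; congr (_ *: _).
by apply/rowP => l; rewrite !mxE.
Qed.

End Frame.

(** * The parameter space *)

Definition param := ('M[CC]_(4, 3) * 'rV[CC]_4)%type.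

Definition param_pt (t : param) : 'I_(4 * 3 + 4) -> CC :=
  fun k => row_mx (mxvec t.1) t.2 ord0 k.

Lemma polyfun_phi i j : polyfun param_pt (fun t => t.1 i j).
Proof.
exists 'X_(lshift 4 (mxvec_index i j)) => t.
by rewrite mevalXU /param_pt row_mxEl mxvecE.
Qed.

Lemma polyfun_h' i : polyfun param_pt (fun t => t.2 0 i).
Proof.
by exists 'X_(rshift (4 * 3) i) => t; rewrite mevalXU /param_pt row_mxEr.
Qed.

Lemma polyfun_mulmx T N (pt : T -> 'I_N -> CC) m n p
    (A : T -> 'M[CC]_(m, n)) (B : T -> 'M[CC]_(n, p)) :
    (forall i j, polyfun pt (fun t => A t i j)) ->
    (forall i j, polyfun pt (fun t => B t i j)) ->
  forall i j, polyfun pt (fun t => (A t *m B t) i j).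
Proof.
move=> pA pB i j.
have [Q QE] : polyfun pt (fun t => \sum_l A t i l * B t l j).
  by apply: polyfun_sum => l; apply: polyfunM.
by exists Q => t; rewrite mxE QE.
Qed.

Lemma polyfun_frame c (F : param -> 'M[CC]_(4, 3)) :
    (forall i j, polyfun param_pt (fun t => F t i j)) ->
  forall i j, polyfun param_pt (fun t => frame c (F t) i j).
Proof.
move=> pF i j; have [j' ->|j' ->] := split_ordP (j : 'I_(3 + 1)).
  by have [Q QE] := pF i j'; exists Q => t; rewrite frameEl QE.
by exists (c i j')%:MP => t; rewrite frameEr mevalC.
Qed.

Lemma polyfun_plane_row c i : polyfun param_pt (fun t => plane_row c t.1 0 i).
Proof.
have [Q QE] : polyfun param_pt
    (fun t => (-1) ^+ (i + v4) * \det (row' i (col' v4 (frame c t.1)))).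
  apply: polyfunM; [exact: polyfun_cst | apply: polyfun_det => x y].
  have [Q QE] := polyfun_frame c polyfun_phi (lift i x) (lift v4 y).
  by exists Q => t; rewrite -QE [LHS]mxE [LHS]mxE.
by exists Q => t; rewrite -QE !mxE.
Qed.

Lemma polyfun_meval T N (pt : T -> 'I_N -> CC) n (P : CPoly n) (f : T -> 'I_n -> CC) :
  (forall i, polyfun pt (f^~ i)) -> polyfun pt (fun t => P.@[f t]).
Proof.
move=> /fin_all_exists [Q QE]; exists (P \mPo [tuple Q i | i < n]) => t.
by rewrite comp_mpoly_meval; apply: meval_eq => i; rewrite tnth_mktuple QE.
Qed.

(** Membership of a linear form in [I] is a linear condition on its coefficients, so a nonzero entry
    of the product with [cokermx W] certifies non-membership on an open set. *)
Lemma generic_notin (I : CPoly 4 -> Prop) T N (pt : T -> 'I_N -> CC)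
    (r : T -> 'rV[CC]_4) t : is_ideal I ->
    (forall i, polyfun pt (fun t => r t 0 i)) -> ~ I (linform (r t)) ->
  generic pt (fun t => ~ I (linform (r t))).
Proof.
move=> iI pr nI.
have [|u v Iu Iv|x u Iu|W WP] := @subspace_mx _ 4 (fun u => I (linform u)).
- rewrite /linform big1 => [|i _]; first exact: ideal0.
  by rewrite mxE scale0r.
- by rewrite linformD; exact: idealD.
- by rewrite linformZ; exact: idealZ.
have /matrix0Pn [x [y xy0]] : r t *m cokermx W != 0.
  by apply/negP; rewrite -submxE => /WP.
have prW : polyfun pt (fun t => (r t *m cokermx W) x y).
  apply: polyfun_mulmx => [i j|i j]; last exact: polyfun_cst.
  by rewrite (ord1 i).
apply: generic_imp (polyfun_generic prW xy0) => t' t'0 /WP.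
by rewrite submxE => /eqP rW0; move: t'0; rewrite rW0 mxE eqxx.
Qed.

(* Right multiplication by [adapted psi] takes the coordinates of the plane to
   coordinates in which the linear form [psi] is a multiple of the last one. *)
Definition adapted (psi : 'rV[CC]_3) : 'M[CC]_3 := \matrix_(i, j)
  if j == ord_max then (i == ord_max)%:R
  else if i == j then psi 0 ord_max
  else if i == ord_max then - psi 0 j else 0.

Lemma mul_adapted (psi : 'rV[CC]_3) :
  psi *m adapted psi = psi 0 ord_max *: delta_mx 0 ord_max.
Proof.
apply/rowP => j; rewrite !mxE /=.
have [->|j_max] := eqVneq j ord_max.
  rewrite (bigD1 ord_max) //= !mxE !eqxx big1 ?addr0 // => i /negPf i_max.
  by rewrite !mxE eqxx i_max mulr0.
rewrite mulr0 (bigD1 ord_max) //= (bigD1 j) //= big1 => [|i /andP [i_max ij]].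
  rewrite !mxE (negPf j_max) eq_sym (negPf j_max) !eqxx addr0 mulrN mulrC addrC.
  by rewrite [psi 0 j * _]mulrC subrr.
by rewrite !mxE (negPf j_max) (negPf ij) (negPf i_max) mulr0.
Qed.

Lemma det_adapted (psi : 'rV[CC]_3) : psi 0 ord_max != 0 -> \det (adapted psi) != 0.
Proof.
move=> psi0; rewrite det_trig; last first.
  apply/is_trig_mxP => x y lt_xy; rewrite mxE.
  have xy : x == y = false by apply/negbTE; rewrite -val_eqE neq_ltn lt_xy.
  have xm : x == ord_max = false.
    apply/negbTE; rewrite -val_eqE neq_ltn (leq_trans lt_xy) //.
    by rewrite -ltnS ltn_ord.
  by rewrite xy xm; case: ifP.
apply/prodf_neq0 => x _; rewrite mxE eqxx; case: (x == ord_max) => /=; last exact: psi0.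
exact: oner_neq0.
Qed.

(** Generically, [H] becomes [x_4 = 0] and its intersection with [H'] becomes [x_3 = x_4 = 0]. No
    division occurs, so the open set defining the generic initial ideal pulls back to the
    parameters. *)
Definition adapted_frame (c : 'cV[CC]_4) (t : param) : 'M[CC]_4 :=
  frame c (t.1 *m adapted (t.2 *m t.1)).

Lemma polyfun_adapted_frame c i j :
  polyfun param_pt (fun t => adapted_frame c t i j).
Proof.
have ppsi x y : polyfun param_pt (fun t => (t.2 *m t.1) x y).
  apply: polyfun_mulmx => [z l|]; last exact: polyfun_phi.
  by rewrite (ord1 z); exact: polyfun_h'.
apply: polyfun_frame => {i j} i j; apply: polyfun_mulmx => [|x y]; first exact: polyfun_phi.
suff [Q QE] : polyfun param_pt (fun t => if y == ord_max then (x == ord_max)%:R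
    else if x == y then (t.2 *m t.1) 0 ord_max
    else if x == ord_max then - (t.2 *m t.1) 0 y else 0).
  by exists Q => t; rewrite mxE QE.
case: (y == _); first exact: polyfun_cst.
case: (x == y); first exact: ppsi.
by case: (x == _); [exact/polyfunN/ppsi | exact: polyfun_cst].
Qed.

Section AdaptedFrame.
Variables (c : 'cV[CC]_4) (t : param).
Let psi := (t.2 *m t.1) 0 ord_max.
Hypothesis det_frame : \det (frame c t.1) != 0.
Hypothesis psi_neq0 : psi != 0.

Let blk : 'M[CC]_(3 + 1) := block_mx (adapted (t.2 *m t.1)) 0 0 1%:M.

Lemma adapted_frameE : adapted_frame c t = frame c t.1 *m blk.
Proof.
have := mul_row_block t.1 c (adapted (t.2 *m t.1)) 0 0 (1%:M : 'M_1).
by rewrite !mulmx0 mulmx1 addr0 add0r => /esym.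
Qed.

Lemma adapted_frame_unit : adapted_frame c t \in unitmx.
Proof.
rewrite unitmxE adapted_frameE det_mulmx unitfE mulf_neq0 //.
have blkE : \det blk = _ := det_ublock (adapted (t.2 *m t.1)) 0 (1%:M : 'M_1).
by rewrite blkE det1 mulr1 det_adapted.
Qed.

Lemma linform_row_mx (r : 'rV[CC]_3) (e : 'rV[CC]_1) :
  linform (row_mx r e : 'rV[CC]_4) =
  \sum_j r 0 j *: 'X_(lshift 1 j : 'I_4) + e 0 0 *: 'X_v4.
Proof.
rewrite /linform (big_split_ord _ (m := 3) (n := 1)) /= big_ord1; congr (_ + _ *: _).
  by apply: eq_bigr => j _; congr (_ *: _); exact: row_mxEl.
exact: row_mxEr.
Qed.

Lemma plane_row_adapted :
  linform (plane_row c t.1) \mPo linsubst (adapted_frame c t) =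
  \det (frame c t.1) *: 'X_v4.
Proof.
rewrite linform_mPo adapted_frameE mulmxA /plane_row -row_mul mul_adj_mx.
rewrite -scalemx1 linearZ /= -scalemxAl linformZ row1; congr (_ *: _).
have -> : delta_mx 0 v4 *m blk = row_mx 0 1%:M.
  have -> : delta_mx 0 v4 = row_mx 0 1%:M :> 'rV[CC]_(3 + 1).
    apply/rowP => x; have [y ->|y ->] := split_ordP x.
      rewrite row_mxEl !mxE eqxx /=; have -> // : (lshift 1 y == v4) = false.
      by apply/eqP => /(congr1 val) /= yE; have := ltn_ord y; rewrite yE.
    by rewrite row_mxEr !mxE (ord1 y) !eqxx.
  have := mul_row_block (0 : 'rV[CC]_3) (1%:M : 'M[CC]_1)
    (adapted (t.2 *m t.1)) 0 0 1%:M.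
  by rewrite !mul0mx !mul1mx addr0 add0r.
rewrite linform_row_mx big1 => [|j _]; last by rewrite mxE scale0r.
by rewrite mxE eqxx scale1r add0r.
Qed.

Lemma h'_adapted : exists e,
  linform t.2 \mPo linsubst (adapted_frame c t) = psi *: 'X_v3 + e *: 'X_v4.
Proof.
exists ((t.2 *m c) 0 0); rewrite linform_mPo.
have -> : t.2 *m adapted_frame c t = _ :=
  mul_mx_row t.2 (t.1 *m adapted (t.2 *m t.1)) c.
rewrite linform_row_mx mulmxA mul_adapted -/psi; congr (_ + _); move: psi => ps.
rewrite (bigD1 ord_max) //= !mxE !eqxx mulr1 big1 ?addr0 // => j /negPf jm.
by rewrite !mxE jm mulr0 scale0r.
Qed.

End AdaptedFrame.

Lemma generic_matrix n (P : CPoly (n * n)) : P != 0 ->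
  exists2 g : 'M[CC]_n, g \in unitmx & P.@[fun k => mxvec g 0 k] != 0.
Proof.
move=> P0; have [i j|Q QE] :=
    @polyfun_det 'M[CC]_n (n * n) (fun g k => mxvec g 0 k) n id.
  by exists 'X_(mxvec_index i j) => g; rewrite mevalXU mxvecE.
have Q0 : Q != 0.
  apply/eqP => Q0; have := QE 1%:M; rewrite Q0 meval0 det1.
  by move/eqP; rewrite oner_eq0.
have [v] := mpoly_nonroot (mulf_neq0 P0 Q0); rewrite mevalM mulf_eq0 negb_or.
pose g : 'M[CC]_n := vec_mx (\row_k v k).
have vE : v =1 (fun k => mxvec g 0 k) by move=> k; rewrite vec_mxK mxE.
rewrite !(meval_eq _ vE) => /andP [Pg Qg]; exists g => //.
by rewrite unitmxE unitfE QE.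
Qed.

Lemma linform_mulmx n k (r : 'rV[CC]_n) (B : 'M[CC]_(n, k)) :
  linform (r *m B) = \sum_j r 0 j *: linform (row j B).
Proof.
rewrite mulmx_sum_row (big_morph (@linform k) (@linformD k) (_ : _ = 0)); last first.
  by rewrite /linform big1 // => i _; rewrite mxE scale0r.
by apply: eq_bigr => j _; rewrite linformZ.
Qed.

Lemma frame_span c phi : \det (frame c phi) != 0 ->
  forall i : 'I_4, exists (x : 'I_3 -> CC) (d : CC),
  'X_i = \sum_j x j *: linform (row j (usubmx (coframe c phi)))
         + d *: linform (plane_row c phi).
Proof.
move=> det0 i; have [d ->] := X_coframe det0 i; exists (phi i), d.
by rewrite row_mul linform_mulmx; congr (_ + _); apply: eq_bigr => j _; rewrite mxE.
Qed.

(** These are the lines of planes, with [H'] fixed, along which [generic_tangent] differentiates. *)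
Lemma frame_line c (t : param) : \det (frame c t.1) != 0 ->
  forall j s, exists t' : param,
  linform (plane_row c t'.1) = linform (plane_row c t.1) +
    s *: (\det (frame c t.1) *: linform (row j (usubmx (coframe c t.1)))) /\
  t'.2 = t.2.
Proof.
move=> det0 j s; exists (t.1 - s *: (c *m delta_mx 0 j), t.2); split=> //=.
by rewrite plane_row_line // linformD linformZ scalerA.
Qed.

(** If every plane had its form in [I], differences along the lines of [frame_line] would put the
    lifted coordinates in [I], hence also ['X_k] by [frame_span]. *)
Lemma plane_notin (I : CPoly 4 -> Prop) c phi k : is_ideal I ->
    \det (frame c phi) != 0 -> ~ I 'X_k ->
  exists t : param, ~ I (linform (plane_row c t.1)).
Proof.
move=> iI det0 nXk; apply: NNPP => /not_ex_not_all allI; apply: nXk.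
have [x [d ->]] := frame_span det0 k.
have Ih := allI (phi, 0); apply: idealD => //; last exact: idealZ.
apply: ideal_sum => // j _; apply: idealZ => //.
have [t' [t'E _]] := frame_line (t := (phi, 0)) det0 j 1.
have := allI t'; rewrite t'E => /(idealB iI) /(_ Ih).
rewrite addrC addKr scale1r => /(idealZ (\det (frame c phi))^-1 iI).
by rewrite scalerK.
Qed.

Lemma adapted_delta : adapted (delta_mx 0 ord_max) = 1%:M.
Proof.
apply/matrixP => i j; rewrite !mxE !eqxx /=.
have [->|jm] := eqVneq j ord_max; first by [].
case: (i == j) => //=; case: (i == ord_max) => //.
by rewrite oppr0.
Qed.

(** * Combining the generic conditions with the descent *)

Theorem theorem11 (I : CPoly 4 -> Prop) (M : 'X_{1..4} -> Prop)
    (i j k a : nat) :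
  is_curve_ideal I -> is_gin I M ->
  min_gen M (mon3 i j k) ->
  (1 <= a <= k)%N ->
  sporadic_zero M i j (k - a) ->
  (* generic H (parametrised by phi) and H' (linear form h') *)
  exists Q : CPoly (4 * 3 + 4)%N, Q != 0%R /\
    forall (phi : 'M[CC]_(4, 3)) (h' : 'rV[CC]_4),
      Q.@[fun t => row_mx (mxvec phi) h' ord0 t] != 0%R ->
      has_syz_le (colon_pow (restr_ideal phi I) (induced_form phi h') a)
                 (i + j + k - a + 2).
Proof.
move=> curveI [P [P0 ginP]] minM /andP [a_gt0 le_ak] _.
have [homI primeI _] := curveI; have iI : is_ideal I := homI.1.
have [s [k' [nXk' indep]]] := two_independent_variables curveI.
set m := (i + j + (k - a))%N.
have -> : (i + j + k - a + 2)%N = m.+2 by rewrite /m; lia.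
(* The base point [t0] comes from an invertible [g0] in the open set of the generic initial ideal:
   [c] is its last column, and [h'0] makes [adapted_frame c t0] equal to [g0]. At [t0] the functions
   behind [gen_det], [gen_psi] and [gen_P] are nonzero. *)
have [g0 g0_unit Pg0] := generic_matrix P0.
pose c : 'cV[CC]_4 := rsubmx (g0 : 'M[CC]_(4, 3 + 1)).
pose phi0 : 'M[CC]_(4, 3) := lsubmx (g0 : 'M[CC]_(4, 3 + 1)).
have g0E : frame c phi0 = g0 by exact: (@hsubmxK _ 4 3 1 g0).
have det0 : \det (frame c phi0) != 0 by rewrite g0E -unitfE -unitmxE.
pose h'0 := row ord_max (usubmx (coframe c phi0)).
have psi0 : h'0 *m phi0 = delta_mx 0 ord_max.
  by have [uphi _ _] := coframeK det0; rewrite -row_mul uphi row1.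
pose t0 : param := (phi0, h'0).
have adapted0 : adapted_frame c t0 = g0.
  by rewrite /adapted_frame /= psi0 adapted_delta mulmx1.
pose h (t : param) := linform (plane_row c t.1).
pose h' (t : param) := linform t.2.
have gen_det : generic param_pt (fun t => \det (frame c t.1) != 0).
  by apply: (polyfun_generic (t := t0)) => //; apply/polyfun_det/polyfun_frame/polyfun_phi.
have gen_psi : generic param_pt (fun t => (t.2 *m t.1) 0 ord_max != 0).
  apply: (polyfun_generic (t := t0)); last by rewrite /= psi0 mxE !eqxx oner_neq0.
  apply: polyfun_mulmx => [x y|]; last exact: polyfun_phi.
  by rewrite (ord1 x); exact: polyfun_h'.
have gen_P : generic param_pt
    (fun t => P.@[fun l => mxvec (adapted_frame c t) 0 l] != 0).
  apply: (polyfun_generic (t := t0)); last by rewrite adapted0.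
  apply: (polyfun_meval P (f := fun t l => mxvec (adapted_frame c t) 0 l)) => l.
  case/mxvec_indexP: l => x y.
  have [Q QE] := polyfun_adapted_frame c x y.
  by exists Q => t; rewrite mxvecE QE.
have gen_h : generic param_pt (fun t => ~ I (h t)).
  have [t1 nIt1] := plane_notin iI det0 nXk'.
  exact: generic_notin iI (polyfun_plane_row c) nIt1.
have gen_h' : generic param_pt (fun t => ~ I (h' t)).
  apply: (generic_notin (t := (0, delta_mx 0 k') : param)) => //; first exact: polyfun_h'.
  by rewrite linform_delta.
(* After [K] steps [growth_contradiction] applies, so tangency is imposed only for the finitely many
   [p < K]. *)
pose K := #|{: 'X_{1..4 < a + m}}|.
have gen_T := generic_all_lt K (fun p => generic_tangent t0 a p m homI
  (polyfam_linear (polyfun_plane_row c) : polyfam param_pt h)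
  (polyfam_linear polyfun_h' : polyfam param_pt h')
  (fun t => linform_homog _) (fun t => linform_homog _)).
have [Q [Q0 QP]] := generic_and (generic_and (generic_and gen_det gen_psi)
  (generic_and gen_P gen_T)) (generic_and gen_h gen_h').
exists Q; split=> // phi h1 /(QP (phi, h1)) [[[/= D0 psi1] [Pt tan]] [nh nh']].
rewrite /h /h' /= in tan nh nh'.
set D := \det (frame c phi) in D0 *.
pose B := usubmx (coframe c phi).
have [phiK _ _] := coframeK D0.
have [e h'E] := h'_adapted c (phi, h1).
have [f hf [Ef nIf]] := gin_element homI (adapted_frame_unit (t := (phi, h1)) D0 psi1)
  (ginP _ Pt (adapted_frame_unit (t := (phi, h1)) D0 psi1)) minM a_gt0 le_ak D0
  (plane_row_adapted c (phi, h1)) h'E.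
move=> g gJ; apply: NNPP => no_syz.
have no_min d : (d <= m.+2)%N -> ~ min_syz_in_deg g d.
  by move=> le_d min_d; apply: no_syz; exists d.
have tangentP p f1 : (p < K)%N -> f1 \is m.-homog ->
    in_mcolon I (linform (plane_row c phi)) (linform h1) a p p.+1 f1 ->
    forall l, exists2 f', f' \is m.-homog &
    in_mcolon I (linform (plane_row c phi)) (linform h1) a p p.+2
      (linform (plane_row c phi) * f' + p.+1%:R *: (linform (row l B) * f1)).
  move=> lt_p hf1 Ef1 l.
  (* The available lines move [h] along [D] times a lifted coordinate, so [f'] is rescaled by [D^-1]
     afterwards. *)
  have [|s'|f' hf' Ef'] := tan p lt_p f1 (D *: linform (row l B)) hf1 _ _ Ef1.
  - exact: dhomogZ (linform_homog _).
  - have [t' [E1 E2]] := frame_line (t := (phi, h1)) D0 l s'.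
    by exists t'; split; [exact: E1 | rewrite E2].
  exists (D^-1 *: f'); first exact: dhomogZ.
  have := in_mcolonZ primeI D^-1 Ef'; congr (in_mcolon _ _ _ _ _ _ _).
  rewrite scalerDr -scalerAr; congr (_ + _).
  by rewrite -scalerAl scalerA [D^-1 * _]mulrC -scalerA scalerK.
have [fp hfp [Efp [r fpE]]] := descent (l := fun j => linform (row j B)) primeI nh
  (linform_homog _) (fun j => linform_homog _)
  (ex_intro _ _ erefl) (fun j => ex_intro _ _ erefl) (frame_span D0)
  (restr_socle phiK (plane_row_phi D0) (X_coframe D0) gJ no_min)
  (restr_koszul phiK (plane_row_phi D0) (X_coframe D0) gJ no_min)
  tangentP (leqnn K) hf Ef.
(* Since [fp] is [f] minus a multiple of the form of [H], having [fp] in [I] contradicts the choice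
   of [f]. *)
apply: (nIf r); rewrite -fpE.
exact: (growth_contradiction homI primeI (linform_homog _) (linform_homog _) nh'
  nXk' indep a_gt0 (leqnn _) hfp Efp).
Qed.
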